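(* Let $\mathcal X$ be a category, $\mathcal C$ a continuous category, and $T^0,\dots,T^n$ flexible functors from $\mathcal X$ to $\mathcal C$. Suppose $G_i\in Hom(T^{i-1},T^i)$ for $i=1,\dots,n$. Then the space of composable $n$-tuples $F\in Hom(T^0,\dots,T^n)$ such that $F_{i-1,i}=G_i$ for all $i=1,\dots,n$ is weakly contractible.
   Context: A continuous category $\mathcal C$ is a category enriched over topological spaces (a set of objects, morphism spaces $\mathcal C(A,B)$, continuous associative composition, identities). **Flexible functors** (always contravariant). For a category $\mathcal Y$, a flexible functor $T:\mathcal Y\to\mathcal C$ consists of an object $T_X$ of $\mathcal C$ for each object $X$ and, for each $n\ge1$ and each composable sequence $\varphi_i:X_i\to X_{i-1}$ ($1\le i\le n$) in $\mathcal Y$, a continuous map $(t_1,\dots,t_{n-1})\mapsto T(\varphi_1,\dots,\varphi_n;t_1,\dots,t_{n-1})$ from $[0,1]^{n-1}$ to $\mathcal C(T_{X_0},T_{X_n})$ such that: if $t_i=0$ it equals $T(\varphi_1,\dots,\varphi_i\varphi_{i+1},\dots,\varphi_n;t_1,\dots,\widehat{t_i},\dots,t_{n-1})$; if $t_i=1$ it equals $T(\varphi_{i+1},\dots,\varphi_n;t_{i+1},\dots,t_{n-1})\circ T(\varphi_1,\dots,\varphi_i;t_1,\dots,t_{i-1})$; and $T(1_X)=1_{T_X}$. Flexible functors with prescribed objects $T_X$ form a topological space, as a subspace of the product over all composable sequences of the spaces of continuous maps $[0,1]^{n-1}\to\mathcal C(T_{X_0},T_{X_n})$ with the compact-open topology.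 Flexible functors restrict along functors. $I^{(n)}$ is the category with objects $0,1,\dots,n$ and exactly one morphism $i\to j$ when $i\ge j$ and none if $i<j$; $I=I^{(1)}$. $Hom(T^0,\dots,T^n)$ (the composable $n$-tuples of morphisms) is the space of flexible functors $F:\mathcal X\times I^{(n)}\to\mathcal C$ with $F|_{\mathcal X\times\{i\}}=T^i$ for all $i$. For $1\le i\le n$, $F_{i-1,i}\in Hom(T^{i-1},T^i)$ is the pullback of $F$ along the inclusion $I\to I^{(n)}$, $k\mapsto k+i-1$. *)

(* Defs.v *)
From HB Require Import structures.
From mathcomp Require Import all_boot all_order all_algebra.
From mathcomp Require Import all_classical all_reals all_analysis.

Set Implicit Arguments.
Unset Strict Implicit.
Unset Printing Implicit Defensive.

Import Order.TTheory GRing.Theory Num.Theory.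
Import numFieldNormedType.Exports.
Local Open Scope classical_set_scope.
Local Open Scope ring_scope.

(* The composite [cat_comp g f] is "g after f". *)
Record category := Category {
  obj :> Type;
  hom : obj -> obj -> Type;
  cat_id : forall A, hom A A;
  cat_comp : forall A B D, hom B D -> hom A B -> hom A D;
  cat_comp1m : forall A B (f : hom A B), cat_comp (cat_id B) f = f;
  cat_compm1 : forall A B (f : hom A B), cat_comp f (cat_id A) = f;
  cat_compA : forall A B D E (h : hom D E) (g : hom B D) (f : hom A B),
    cat_comp h (cat_comp g f) = cat_comp (cat_comp h g) f
}.

Record functor (Y Z : category) := Functor {
  fobj :> Y -> Z;
  fmap : forall A B, hom A B -> hom (fobj A) (fobj B);
  fmap_id : forall A, fmap (cat_id A) = cat_id (fobj A);
  fmap_comp : forall A B D (g : hom B D) (f : hom A B),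
    fmap (cat_comp g f) = cat_comp (fmap g) (fmap f)
}.

Section ProductCategory.
Variables Y Z : category.

Definition prod_hom (p q : Y * Z) : Type := (hom p.1 q.1 * hom p.2 q.2)%type.

Program Definition prod_cat : category := {|
  obj := (Y * Z)%type;
  hom := prod_hom;
  cat_id p := (cat_id p.1, cat_id p.2);
  cat_comp p q r g f := (cat_comp g.1 f.1, cat_comp g.2 f.2)
|}.
Next Obligation. by move=> A B [f1 f2]; rewrite !cat_comp1m. Qed.
Next Obligation. by move=> A B [f1 f2]; rewrite !cat_compm1. Qed.
Next Obligation. by move=> *; congr pair; apply: cat_compA. Qed.

End ProductCategory.

(* [ordcat n] is the category I^(n): the proof-irrelevant proposition
   [j <= i] is the type of morphisms from [i] to [j]. *)
Program Definition ordcat (n : nat) : category := {|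
  obj := 'I_n.+1;
  hom i j := (j <= i)%N;
  cat_id i := leqnn i;
  cat_comp i j k g f := leq_trans g f
|}.
Next Obligation. by move=> *; apply: bool_irrelevance. Qed.
Next Obligation. by move=> *; apply: bool_irrelevance. Qed.
Next Obligation. by move=> *; apply: bool_irrelevance. Qed.

Record continuous_category := ContinuousCategory {
  cobj :> Type;
  chom : cobj -> cobj -> topologicalType;
  cid : forall A, chom A A;
  ccomp : forall A B D, chom B D -> chom A B -> chom A D;
  ccomp1m : forall A B (f : chom A B), ccomp (cid B) f = f;
  ccompm1 : forall A B (f : chom A B), ccomp f (cid A) = f;
  ccompA : forall A B D E (h : chom D E) (g : chom B D) (f : chom A B),
    ccomp h (ccomp g f) = ccomp (ccomp h g) f;
  ccomp_continuous : forall A B D,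
    continuous (fun gf : chom B D * chom A B => ccomp gf.1 gf.2)
}.

Section Spaces.
Variable R : realType.

Definition unit_interval : topologicalType := set_type `[(0 : R), 1]%classic.

Definition cube (m : nat) : topologicalType :=
  prod_topology (fun _ : 'I_m => unit_interval).

Definition cube_boundary (m : nat) : set (cube m) :=
  [set t | exists i, \val (t i) = 0 \/ \val (t i) = 1].

Definition map_space (S Z : topologicalType) : topologicalType :=
  initial_topology (id : continuousType S Z -> {compact-open, S -> Z}).

Definition homotopic_rel (S Z : topologicalType) (A : set S) (f g : S -> Z) :=
  exists H : S * unit_interval -> Z,
    [/\ continuous H,
        forall x s, \val s = 0 -> H (x, s) = f x,
        forall x s, \val s = 1 -> H (x, s) = g x &
        forall x s, A x -> H (x, s) = f x].

(* The class of every k-fold loop at z is trivial in pi_k(Z, z); as the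
   boundary of the 0-cube is empty, the case k = 0 says that every point of Z
   is connected to z by a path. *)
Definition trivial_homotopy_group (k : nat) (Z : topologicalType) (z : Z) :=
  forall f : cube k -> Z, continuous f ->
    (forall t, cube_boundary t -> f t = z) ->
    homotopic_rel (@cube_boundary k) f (cst z).

Definition weakly_contractible (Z : topologicalType) :=
  [set: Z] !=set0 /\ forall k (z : Z), trivial_homotopy_group k z.

End Spaces.

Section Sequences.
Variable Y : category.

(* [chain m A B] is the type of composable sequences phi_1, ..., phi_(m+1)
   of m + 1 >= 1 morphisms phi_i : X_i -> X_(i-1) with X_0 = A and
   X_(m+1) = B. *)
Inductive chain : nat -> Y -> Y -> Type :=
  | chain1 A B (f : hom B A) : chain 0 A B
  | chainS m A X B (f : hom X A) (c : chain m X B) : chain m.+1 A B.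

Fixpoint chain_cat p q (A B D : Y) (a : chain p A B) :
    chain q B D -> chain (p + q).+1 A D :=
  match a in chain p A B return chain q B D -> chain (p + q).+1 A D with
  | chain1 _ _ f => fun b => chainS f b
  | chainS _ _ _ _ f a' => fun b => chainS f (chain_cat a' b)
  end.

Definition chain_precomp q (A B D : Y) (f : hom B A) (b : chain q B D) :
    chain q A D :=
  match b in chain q B D return hom B A -> chain q A D with
  | chain1 _ _ g => fun f => chain1 (cat_comp f g)
  | chainS _ _ _ _ g b' => fun f => chainS (cat_comp f g) b'
  end f.

(* The concatenation of two sequences (.., phi_i) and (phi_(i+1), ..) with
   phi_i and phi_(i+1) replaced by their composite. *)
Fixpoint chain_merge p q (A B D : Y) (a : chain p A B) :
    chain q B D -> chain (p + q) A D :=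
  match a in chain p A B return chain q B D -> chain (p + q) A D with
  | chain1 _ _ f => fun b => chain_precomp f b
  | chainS _ _ _ _ f a' => fun b => chainS f (chain_merge a' b)
  end.

Record composable_sequence := ComposableSequence {
  cs_dim : nat;
  cs_src : Y;
  cs_tgt : Y;
  cs_chain :> chain cs_dim cs_src cs_tgt
}.

End Sequences.

Section ChainMap.
Variables (Y Z : category) (P : functor Y Z).

Fixpoint chain_map m (A B : Y) (c : chain m A B) : chain m (P A) (P B) :=
  match c in chain m A B return chain m (P A) (P B) with
  | chain1 _ _ f => chain1 (fmap P f)
  | chainS _ _ _ _ f c' => chainS (fmap P f) (chain_map c')
  end.

Lemma chain_map_cat p q (A B D : Y) (a : chain p A B) (b : chain q B D) :
  chain_map (chain_cat a b) = chain_cat (chain_map a) (chain_map b).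
Proof. by elim: a b => //= m A' X' B' f a IH b; rewrite IH. Qed.

Lemma chain_map_merge p q (A B D : Y) (a : chain p A B) (b : chain q B D) :
  chain_map (chain_merge a b) = chain_merge (chain_map a) (chain_map b).
Proof.
elim: a b => /= [A' B' f b|m A' X' B' f a IH b]; last by rewrite IH.
by case: b f => /= *; rewrite fmap_comp.
Qed.

Definition sequence_map (s : composable_sequence Y) : composable_sequence Z :=
  ComposableSequence (chain_map s).

End ChainMap.

Section FlexibleFunctors.
Variables (R : realType) (C : continuous_category).

Section CubeCoordinates.
Variables p q : nat.
Implicit Type t : cube R (p + q).+1.

(* the index of t_(p+1), whose 0-based position is p *)
Definition cut_pos : 'I_(p + q).+1 :=
  Ordinal (leq_addr q p : (p < (p + q).+1)%N).
Definition cube_drop t : cube R (p + q) := fun j => t (lift cut_pos j).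
Definition cube_before t : cube R p := fun j => t (lift cut_pos (lshift q j)).
Definition cube_after t : cube R q := fun j => t (lift cut_pos (rshift p j)).

End CubeCoordinates.

Section Space.
Variables (Y : category) (O : Y -> C).

Definition prefunctor_space : topologicalType :=
  prod_topology (fun s : composable_sequence Y =>
    map_space (cube R (cs_dim s)) (chom (O (cs_src s)) (O (cs_tgt s)))).

Definition value (F : prefunctor_space) m (A B : Y) (c : chain m A B)
  : cube R m -> chom (O A) (O B) := F (ComposableSequence c).

(* A sequence of length n >= 2 together with 1 <= i <= n - 1 is the same thing
   as a concatenation of (phi_1, .., phi_i) and (phi_(i+1), .., phi_n). *)
Definition is_flexible : set prefunctor_space := [set F |
  [/\ forall p q (A B D : Y) (a : chain p A B) (b : chain q B D)
             (t : cube R (p + q).+1), \val (t (cut_pos p q)) = 0 ->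
        value F (chain_cat a b) t = value F (chain_merge a b) (cube_drop t),
      forall p q (A B D : Y) (a : chain p A B) (b : chain q B D)
             (t : cube R (p + q).+1), \val (t (cut_pos p q)) = 1 ->
        value F (chain_cat a b) t =
        ccomp (value F b (cube_after t)) (value F a (cube_before t)) &
      forall (A : Y) (t : cube R 0),
        value F (chain1 (cat_id A)) t = cid (O A)]].

Definition flexible_space : topologicalType := set_type is_flexible.

End Space.

Arguments is_flexible {Y} O _.

Record flexible_functor (Y : category) := FlexibleFunctor {
  ff_obj :> Y -> C;
  ff_map : flexible_space ff_obj
}.

Section Restriction.
Variables (Y Z : category) (P : functor Y Z) (O : Z -> C).

Definition pullback (F : prefunctor_space O) :
    prefunctor_space (fun A => O (P A)) :=
  fun s => F (sequence_map P s).

Lemma ff_restrict_subproof (F : flexible_space O) :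
  pullback (\val F) \in is_flexible (fun A => O (P A)).
Proof.
case: F => F /= /set_mem[F0 F1 Fid]; apply/mem_set; split.
- move=> p q A B D a b t t0.
  have := F0 p q _ _ _ (chain_map P a) (chain_map P b) t t0.
  by rewrite -chain_map_cat -chain_map_merge.
- move=> p q A B D a b t t1.
  have := F1 p q _ _ _ (chain_map P a) (chain_map P b) t t1.
  by rewrite -chain_map_cat.
- move=> A t; rewrite -(Fid (P A) t) -fmap_id; reflexivity.
Qed.

Definition ff_restrict (F : flexible_space O) :
    flexible_space (fun A => O (P A)) :=
  exist (fun H => H \in is_flexible _) _ (ff_restrict_subproof F).

End Restriction.

Section Hom.
Variable X : category.

(* the inclusion X = X x {i} -> X x I^(n) *)
Program Definition level n (i : 'I_n.+1) :
    functor X (prod_cat X (ordcat n)) := {|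
  fobj A := (A, i);
  fmap A B f := (f, leqnn i)
|}.
Next Obligation. by []. Qed.
Next Obligation. by move=> *; congr pair; apply: bool_irrelevance. Qed.

Definition Hom_objects n (T : 'I_n.+1 -> flexible_functor X)
  (A : prod_cat X (ordcat n)) : C := T A.2 A.1.

Definition restricts_to n (T : 'I_n.+1 -> flexible_functor X) :
    set (flexible_space (Hom_objects T)) :=
  [set F | forall i, ff_restrict (level i) F = ff_map (T i)].

Arguments restricts_to {n} T _.

(* Hom(T^0, ..., T^n) *)
Definition Hom_space n (T : 'I_n.+1 -> flexible_functor X) : topologicalType :=
  set_type (restricts_to T).

(* k |-> k + i; with i counted from 0, these are the consecutive objects
   i and i + 1 of I^(n). *)
Definition ord_step n (i : 'I_n) (k : 'I_2) : 'I_n.+1 := inord (i + k).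

Lemma val_ord_step n (i : 'I_n) (k : 'I_2) : ord_step i k = (i + k)%N :> nat.
Proof.
by rewrite inordK// ltnS -[n in (_ <= n)%N](subnKC (ltn_ord i)) addSnnS
  leq_add2l (leq_trans (_ : k <= 1)%N)// -ltnS.
Qed.

Lemma ord_step_hom n (i : 'I_n) (j k : 'I_2) :
  (k <= j)%N -> (ord_step i k <= ord_step i j)%N.
Proof. by rewrite !val_ord_step leq_add2l. Qed.

Program Definition edge_functor n (i : 'I_n) :
    functor (prod_cat X (ordcat 1)) (prod_cat X (ordcat n)) := {|
  fobj A := (A.1, ord_step i A.2);
  fmap A B f := (f.1, ord_step_hom i f.2)
|}.
Next Obligation. by move=> *; congr pair; apply: bool_irrelevance. Qed.
Next Obligation. by move=> *; congr pair; apply: bool_irrelevance. Qed.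

Section Edge.
Variables (n : nat) (T : 'I_n.+1 -> flexible_functor X) (i : 'I_n).

Lemma chain_map_level_edge m (k : 'I_2) (A B : X) (c : chain m A B) :
  chain_map (edge_functor i) (chain_map (level k) c) =
  chain_map (level (ord_step i k)) c.
Proof.
elim: c => /= [A' B' f|p A' X' B' f c IH].
  by congr chain1; congr pair; apply: bool_irrelevance.
by rewrite -IH; congr chainS; congr pair; apply: bool_irrelevance.
Qed.

Lemma Hom_edge_subproof (F : Hom_space T) :
  (ff_restrict (edge_functor i) (\val F)
    : flexible_space (Hom_objects (fun k => T (ord_step i k))))
  \in restricts_to (fun k => T (ord_step i k)).
Proof.
case: F => F /= /set_mem FT; apply/mem_set => k /=.
rewrite -FT; apply: val_inj => /=; apply: functional_extensionality_dep.
case=> m A B c; rewrite /pullback /sequence_map /=.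
by rewrite -chain_map_level_edge.
Qed.

(* F_(i-1,i), with i counted from 0 here *)
Definition Hom_edge (F : Hom_space T) : Hom_space (fun k => T (ord_step i k)) :=
  exist (fun H => H \in restricts_to _) _ (Hom_edge_subproof F).

End Edge.
End Hom.
End FlexibleFunctors.

(* Main.v *)
Require Import Defs.
From mathcomp Require Import all_boot all_order all_algebra.
From mathcomp Require Import all_classical all_reals all_analysis.
From mathcomp Require Import zify lra.
From Stdlib Require Eqdep.
Import Defs.

(* It suffices to extend to a whole cube of parameters every family of
   extensions that is given on its boundary.  Only the sequences of morphisms
   of X x I^(n) whose levels spread over at least two steps are not prescribed
   yet.  Let q be the level following the first one in such a sequence c, and
   let (x, l) be the first vertex of c with l > q.  Inserting the vertex (x, q)
   just before it, with the identity of x as new morphism, gives a sequence c',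
   and the face of the cube of c' on which the inserted vertex is deleted is
   the cube of c.  The values on all the other faces of c' are composites of
   known values, or known by induction, so that a retraction of the cube onto
   this open box fills the cube of c' and thereby determines the value on c.

   If c contains identities on level q, then several vertices of c' may be
   deleted to obtain c, and c' itself is one of the sequences to be treated.
   The filling of the cube of c' is therefore not used as the value on c', but
   kept as an auxiliary datum: c' is considered with the inserted vertex marked.
   On the faces on which an unmarked vertex of level q is deleted, the filling
   is compared with the filling of the smaller marked sequence; on the other
   faces, it is compared with the values on unmarked sequences. *)

Set Implicit Arguments.
Unset Strict Implicit.
Unset Printing Implicit Defensive.

Import Order.TTheory GRing.Theory Num.Theory.
Import numFieldNormedType.Exports.
Local Open Scope classical_set_scope.
Local Open Scope ring_scope.

(** * Composable sequences *)

Section Routes.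
Variable Y : category.

(* [chain] without the length index, so that the associativity laws below are
   plain equalities *)
Inductive route : Y -> Y -> Type :=
  | route1 A B (f : hom B A) : route A B
  | routeS A X B (f : hom X A) (c : route X B) : route A B.

(* Counts the inner vertices: one less than the number of morphisms. *)
Fixpoint rsize A B (c : route A B) : nat :=
  if c is routeS _ _ _ _ c' then (rsize c').+1 else 0.

Fixpoint rcat A B D (a : route A B) : route B D -> route A D :=
  match a in route A B return route B D -> route A D with
  | route1 _ _ f => fun b => routeS f b
  | routeS _ _ _ f a' => fun b => routeS f (rcat a' b)
  end.

Definition rprecomp A B D (f : hom B A) (b : route B D) : route A D :=
  match b in route B D return hom B A -> route A D with
  | route1 _ _ g => fun f => route1 (cat_comp f g)
  | routeS _ _ _ g b' => fun f => routeS (cat_comp f g) b'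
  end f.

Fixpoint rmerge A B D (a : route A B) : route B D -> route A D :=
  match a in route A B return route B D -> route A D with
  | route1 _ _ f => fun b => rprecomp f b
  | routeS _ _ _ f a' => fun b => routeS f (rmerge a' b)
  end.

Record cut (A B : Y) :=
  Cut { cmid : Y; cleft : route A cmid; cright : route cmid B }.

Definition ccat A B (x : cut A B) := rcat (cleft x) (cright x).
Definition cmerge A B (x : cut A B) := rmerge (cleft x) (cright x).

(** Inner vertices are numbered from 0. Being a function of the sequence, [dec] turns an equality of
    concatenations into an equality of cuts, whose middle objects may differ, without inverting a
    dependent equality. *)
Fixpoint dec A B (c : route A B) (i : nat) : option (cut A B) :=
  match c in route A B return option (cut A B) with
  | route1 _ _ _ => None
  | routeS _ _ _ f c' =>
    if i is j.+1 then
      omap (fun x => Cut (routeS f (cleft x)) (cright x)) (dec c' j)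
    else Some (Cut (route1 f) c')
  end.

Lemma rsize_cat A B D (a : route A B) (b : route B D) :
  rsize (rcat a b) = (rsize a + rsize b).+1.
Proof. by elim: a b => //= A' X B' f a IH b; rewrite IH. Qed.

Lemma rsize_precomp A B D (f : hom B A) (b : route B D) :
  rsize (rprecomp f b) = rsize b.
Proof. by case: b f. Qed.

Lemma rsize_merge A B D (a : route A B) (b : route B D) :
  rsize (rmerge a b) = (rsize a + rsize b)%N.
Proof.
elim: a b => [A' B' f b|A' X B' f a IH b] /=; first exact: rsize_precomp.
by rewrite IH.
Qed.

Lemma rcatA A B D E (a : route A B) (b : route B D) (c : route D E) :
  rcat (rcat a b) c = rcat a (rcat b c).
Proof. by elim: a b => //= A' X B' f a IH b; rewrite IH. Qed.

Lemma rmerge_catl A B D E (a : route A B) (b : route B D) (c : route D E) :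
  rmerge (rcat a b) c = rcat a (rmerge b c).
Proof. by elim: a b => //= A' X B' f a IH b; rewrite IH. Qed.

Lemma rcat_mergel A B D E (a : route A B) (b : route B D) (c : route D E) :
  rcat (rmerge a b) c = rmerge a (rcat b c).
Proof.
elim: a b => [A' B' f b|A' X B' f a IH b] /=; last by rewrite IH.
by case: b f c.
Qed.

Lemma rmergeA A B D E (a : route A B) (b : route B D) (c : route D E) :
  rmerge (rmerge a b) c = rmerge a (rmerge b c).
Proof.
elim: a b => [A' B' f b|A' X B' f a IH b] /=; last by rewrite IH.
case: b f c => //= A1 B1 g f c.
by case: c f g => /= *; rewrite cat_compA.
Qed.

Lemma dec_cat A B D (a : route A B) (b : route B D) :
  dec (rcat a b) (rsize a) = Some (Cut a b).
Proof. by elim: a b => //= A' X B' f a IH b; rewrite IH. Qed.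

Lemma dec_cat_l A B D (a : route A B) (b : route B D) i : (i < rsize a)%N ->
  dec (rcat a b) i =
  omap (fun x => Cut (cleft x) (rcat (cright x) b)) (dec a i).
Proof.
elim: a b i => //= A' X B' f a IH b [|i] //=; rewrite ltnS => /IH->.
by case: dec.
Qed.

Lemma dec_cat_r A B D (a : route A B) (b : route B D) i :
  dec (rcat a b) (rsize a + i).+1 =
  omap (fun x => Cut (rcat a (cleft x)) (cright x)) (dec b i).
Proof.
elim: a b => /= [A' B' f b|A' X B' f a IH b] //=.
by rewrite IH; case: dec.
Qed.

Lemma dec_merge_l A B D (a : route A B) (b : route B D) i : (i < rsize a)%N ->
  dec (rmerge a b) i =
  omap (fun x => Cut (cleft x) (rmerge (cright x) b)) (dec a i).
Proof.
elim: a b i => //= A' X B' f a IH b [|i] //=; rewrite ltnS => /IH->.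
by case: dec.
Qed.

Lemma dec_merge_r A B D (a : route A B) (b : route B D) i :
  dec (rmerge a b) (rsize a + i) =
  omap (fun x => Cut (rmerge a (cleft x)) (cright x)) (dec b i).
Proof.
elim: a b => /= [A' B' f b|A' X B' f a IH b] //=.
  by case: b f => //= A1 X1 B1 g b f; case: i => //= i; case: dec.
by rewrite IH; case: dec.
Qed.

Lemma dec_split A B (c : route A B) i : (i < rsize c)%N ->
  exists x, [/\ dec c i = Some x, c = ccat x & rsize (cleft x) = i].
Proof.
elim: c i => //= A' X B' f c IH [|i]; first by exists (Cut (route1 f) c).
rewrite ltnS => /IH[x [-> -> <-]].
by exists (Cut (routeS f (cleft x)) (cright x)).
Qed.

Lemma dec_None A B (c : route A B) i : (rsize c <= i)%N -> dec c i = None.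
Proof. by elim: c i => //= A' X B' f c IH [|i] //; rewrite ltnS => /IH->. Qed.

Lemma triple_cut A B (c : route A B) i j : (i < j < rsize c)%N ->
  exists X1 X2 (d1 : route A X1) (d2 : route X1 X2) (d3 : route X2 B),
  [/\ c = rcat d1 (rcat d2 d3), rsize d1 = i & j = (i + rsize d2).+1].
Proof.
move=> /andP[ij /dec_split[[X2 l d3] [_ -> /= lj]]].
have /dec_split[[X1 d1 d2] [_ le li]] : (i < rsize l)%N by rewrite lj.
exists X1, X2, d1, d2, d3; rewrite /ccat /= le /ccat rcatA; split=> //.
by rewrite -lj le /ccat rsize_cat /= li.
Qed.

Lemma dec_ccat A B (x : cut A B) : dec (ccat x) (rsize (cleft x)) = Some x.
Proof. by rewrite /ccat dec_cat; case: x. Qed.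

(** [dec] at the position of [y] recovers [y] from [ccat x]; the three cases are a position before,
    at or after that of [x]. *)
Lemma ccat_eq_ccat A B (x y : cut A B) : ccat y = ccat x ->
  [\/ exists u : cut A (cmid x), ccat u = cleft x /\
        y = Cut (cleft u) (rcat (cright u) (cright x)),
      y = x |
      exists u : cut (cmid x) B, ccat u = cright x /\
        y = Cut (rcat (cleft x) (cleft u)) (cright u)].
Proof.
move=> yx; have := dec_ccat y; rewrite yx.
have [ja|ja|ja] := ltngtP (rsize (cleft y)) (rsize (cleft x)).
- rewrite /ccat dec_cat_l//; have [u [-> eu _] /Some_inj <-] := dec_split ja.
  by constructor 1; exists u.
- have /(congr1 (@rsize A B)) := yx; rewrite /ccat !rsize_cat => -[sz].
  have jb : (rsize (cleft y) - (rsize (cleft x)).+1 < rsize (cright x))%N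
    by lia.
  rewrite -(subnKC ja) addSn dec_cat_r.
  have [u [-> eu _] /Some_inj <-] := dec_split jb.
  by constructor 3; exists u.
- by rewrite ja dec_ccat => /Some_inj; constructor 2.
Qed.

(** The vertex [cmid x] has disappeared here, so a position equal to [rsize (cleft x)] already
    belongs to the right half. *)
Lemma ccat_eq_cmerge A B (x y : cut A B) : ccat y = cmerge x ->
  (exists u : cut A (cmid x), ccat u = cleft x /\
     y = Cut (cleft u) (rmerge (cright u) (cright x))) \/
  (exists u : cut (cmid x) B, ccat u = cright x /\
     y = Cut (rmerge (cleft x) (cleft u)) (cright u)).
Proof.
move=> yx; have := dec_ccat y; rewrite yx /cmerge.
have [ja|ja] := ltnP (rsize (cleft y)) (rsize (cleft x)).
  rewrite dec_merge_l//; have [u [-> eu _] /Some_inj <-] := dec_split ja.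
  by left; exists u.
have /(congr1 (@rsize A B)) := yx; rewrite /ccat /cmerge rsize_cat rsize_merge.
move=> sz.
have jb : (rsize (cleft y) - rsize (cleft x) < rsize (cright x))%N by lia.
rewrite -(subnKC ja) dec_merge_r.
have [u [-> eu _] /Some_inj <-] := dec_split jb.
by right; exists u.
Qed.

Section Count.
Variable P : pred Y.

Fixpoint rcount A B (c : route A B) : nat :=
  if c is routeS _ X _ _ c' then (P X + rcount c')%N else 0.

Lemma rcount_cat A B D (a : route A B) (b : route B D) :
  rcount (rcat a b) = (rcount a + P B + rcount b)%N.
Proof. by elim: a b => //= A' X B' f a IH b; rewrite IH; lia. Qed.

Lemma rcount_merge A B D (a : route A B) (b : route B D) :
  rcount (rmerge a b) = (rcount a + rcount b)%N.
Proof.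
elim: a b => [A' B' f b|A' X B' f a IH b] /=; first by case: b f.
by rewrite IH; lia.
Qed.

Lemma rcount_le A B (a : route A B) : (rcount a <= rsize a)%N.
Proof. by elim: a => //= A' X B' f a IH; case: (P X) => /=; lia. Qed.

End Count.

Lemma route_le (lev : Y -> nat) (A B : Y) :
  (forall A B : Y, hom B A -> (lev A <= lev B)%N) ->
  route A B -> (lev A <= lev B)%N.
Proof.
move=> mono c; elim: c => [A' B' f|A' X B' f c]; first exact: mono.
exact/leq_trans/mono.
Qed.

Fixpoint route_hom (A B : Y) (c : route A B) : hom B A :=
  match c in route A B return hom B A with
  | route1 _ _ f => f
  | routeS _ _ _ f c' => cat_comp f (route_hom c')
  end.

End Routes.

(** * Passage between chains and routes *)

Section Conversion.
Variable Y : category.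

Fixpoint of_chain m (A B : Y) (c : chain m A B) : route A B :=
  match c in chain m A B return route A B with
  | chain1 _ _ f => route1 f
  | chainS _ _ _ _ f c' => routeS f (of_chain c')
  end.

Fixpoint to_chain (A B : Y) (c : route A B) : chain (rsize c) A B :=
  match c as c in route A B return chain (rsize c) A B with
  | route1 _ _ f => chain1 f
  | routeS _ _ _ f c' => chainS f (to_chain c')
  end.

Lemma of_chain_cat p q (A B D : Y) (a : chain p A B) (b : chain q B D) :
  of_chain (chain_cat a b) = rcat (of_chain a) (of_chain b).
Proof. by elim: a b => //= m A' X' B' f a IH b; rewrite IH. Qed.

Lemma of_chain_merge p q (A B D : Y) (a : chain p A B) (b : chain q B D) :
  of_chain (chain_merge a b) = rmerge (of_chain a) (of_chain b).
Proof.
elim: a b => /= [A' B' f b|m A' X' B' f a IH b]; last by rewrite IH.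
by case: b f.
Qed.

Lemma rsize_of_chain m (A B : Y) (c : chain m A B) : rsize (of_chain c) = m.
Proof. by elim: c => //= *; congr S. Qed.

(** The length is packed with the chain because lengths such as [rsize (rcat a b)] and
    [(rsize a + rsize b).+1] are equal but not convertible. *)
Definition sroute (A B : Y) (c : route A B) : {m & chain m A B} :=
  existT (fun m => chain m A B) (rsize c) (to_chain c).

Definition schainS (A X B : Y) (f : hom X A) (s : {m & chain m X B}) :
  {m & chain m A B} := let: existT m c := s in
  existT (fun m => chain m A B) m.+1 (chainS f c).

Lemma sroute_of_chain m (A B : Y) (c : chain m A B) :
  sroute (of_chain c) = existT (fun m => chain m A B) m c.
Proof.
elim: c => //= p A' X B' f c IH.
by transitivity (schainS f (sroute (of_chain c))); last rewrite IH.
Qed.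

Lemma sroute_cat (A B D : Y) (a : route A B) (b : route B D) :
  sroute (rcat a b) =
  existT (fun m => chain m A D) _ (chain_cat (to_chain a) (to_chain b)).
Proof.
elim: a b => //= A' X B' f a IH b.
by transitivity (schainS f (sroute (rcat a b))); last rewrite IH.
Qed.

Lemma sroute_merge (A B D : Y) (a : route A B) (b : route B D) :
  sroute (rmerge a b) =
  existT (fun m => chain m A D) _ (chain_merge (to_chain a) (to_chain b)).
Proof.
elim: a b => /= [A' B' f b|A' X B' f a IH b]; first by case: b f.
by transitivity (schainS f (sroute (rmerge a b))); last rewrite IH.
Qed.

End Conversion.

Section RouteMap.
Variables (Y Z : category) (P : functor Y Z).

Fixpoint rmap (A B : Y) (c : route A B) : route (P A) (P B) :=
  match c in route A B return route (P A) (P B) with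
  | route1 _ _ f => route1 (fmap P f)
  | routeS _ _ _ f c' => routeS (fmap P f) (rmap c')
  end.

Lemma dec_rmap (A B : Y) (c : route A B) i :
  dec (rmap c) i =
  omap (fun x => Cut (rmap (cleft x)) (rmap (cright x))) (dec c i).
Proof.
by elim: c i => //= A' X B' f c IH [|i] //=; rewrite IH; case: dec.
Qed.

Lemma rmap_cat (A B D : Y) (a : route A B) (b : route B D) :
  rmap (rcat a b) = rcat (rmap a) (rmap b).
Proof. by elim: a b => //= A' X' B' f a IH b; rewrite IH. Qed.

Lemma rmap_merge (A B D : Y) (a : route A B) (b : route B D) :
  rmap (rmerge a b) = rmerge (rmap a) (rmap b).
Proof.
elim: a b => /= [A' B' f b|A' X' B' f a IH b]; last by rewrite IH.
by case: b f => /= *; rewrite fmap_comp.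
Qed.

Lemma rsize_rmap (A B : Y) (c : route A B) : rsize (rmap c) = rsize c.
Proof. by elim: c => //= *; congr S. Qed.

End RouteMap.

(** * Retraction of a cube onto an open box *)

Section Topology.

Lemma continuous_into_prod (S : topologicalType) (I : Type)
    (T : I -> topologicalType) (f : S -> prod_topology T) :
  (forall i, continuous (fun s => f s i)) -> continuous f.
Proof.
move=> cf s; apply/cvg_sup => i.
by apply: (@continuous_comp_initial _ _ _ (fun g : prod_topology T => g i)) s.
Qed.

Lemma continuous_eval (I : Type) (T : I -> topologicalType) (i : I) :
  continuous (fun g : prod_topology T => g i).
Proof.
move=> g A; have /cvg_sup/(_ i) h : g --> g by exact: cvg_id.
by move=> /initial_continuous/h.
Qed.

Lemma continuous_pair (S T U : topologicalType) (f : S -> T) (g : S -> U) :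
  continuous f -> continuous g -> continuous (fun s => (f s, g s)).
Proof. by move=> cf cg s; apply: cvg_pair; [exact: cf|exact: cg]. Qed.

(** Near [s], the closed sets missing [s] can be avoided, and on the finitely many others [v i] is
    continuous. Continuity of [v i] is asked only if [D i] is inhabited: nothing is known about the
    value attached to the missing face of a box. *)
Lemma continuous_paste (S Z : topologicalType) (I : finType) (D : I -> set S)
    (v : I -> S -> Z) (W : S -> Z) :
  (forall i, closed (D i)) -> (forall i s, D i s -> continuous (v i)) ->
  (forall s, exists i, D i s) -> (forall i s, D i s -> W s = v i s) ->
  continuous W.
Proof.
move=> Dcl vc Dcov DW s A; rewrite nbhsE => -[U [Uop Us] UA].
have nb i : nbhs s (~` D i `|` v i @^-1` U).
  have [Dis|Dis] := pselect (D i s).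
    have /(vc i s Dis) h : nbhs (v i s) U by apply: open_nbhs_nbhs; rewrite -DW.
    by apply: (@filterS _ (nbhs s) _ (v i @^-1` U)) => // s' ?; right.
  have /open_nbhs_nbhs h : open_nbhs s (~` D i).
    by split=> //; exact: closed_openC.
  by apply: (@filterS _ (nbhs s) _ (~` D i)) => // s' ?; left.
apply: filterS (filter_forall _ nb) => s' h; have [i Di] := Dcov s'.
by apply: UA; have [//|] := h i; rewrite (DW i).
Qed.

End Topology.

Section BoxRetraction.
Variable R : realType.

(** One cube with coordinates indexed by [nat] replaces the cubes of all dimensions; the dimension
    is recorded by saying on which coordinates a function depends. Deleting or inserting a
    coordinate then needs no cast. *)
Definition Ivec : topologicalType :=
  prod_topology (fun _ : nat => unit_interval R).

Definition onface (u : Ivec) (i : nat) (e : bool) : Prop :=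
  \val (u i) = e%:R.

Lemma clamp_subproof (x : R) :
  Num.max 0 (Num.min 1 x) \in `[(0 : R), 1]%classic.
Proof.
by apply/mem_set; rewrite /= in_itv /= le_max lexx /= ge_max ler01 ge_min lexx.
Qed.

Definition clamp (x : R) : unit_interval R :=
  exist (fun y => y \in `[(0 : R), 1]%classic) _ (clamp_subproof x).

Lemma val_unit (x : unit_interval R) : 0 <= \val x <= 1.
Proof. by case: x => x /= /set_mem; rewrite /= in_itv. Qed.

Lemma clampE x : 0 <= x <= 1 -> \val (clamp x) = x.
Proof. by move=> /andP[x0 x1] /=; rewrite min_r// max_r. Qed.

Lemma clamp_val (x : unit_interval R) : clamp (\val x) = x.
Proof. by apply: val_inj; apply: clampE; exact: val_unit. Qed.

Lemma val_unit_continuous : continuous (fun x : unit_interval R => \val x).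
Proof. exact: initial_continuous. Qed.

Lemma clamp_continuous : continuous clamp.
Proof.
apply: continuous_comp_initial => x.
apply: (@continuous_max _ _ (cst 0 : R -> R^o)); first exact: cst_continuous.
by apply: (@continuous_min _ _ (cst 1 : R -> R^o)); first exact: cst_continuous.
Qed.

Definition maxabs (u : nat -> R) (b : R) (l : seq nat) : R :=
  foldr (fun i m => Num.max `|u i| m) b l.

Lemma maxabs_base u b l : b <= maxabs u b l.
Proof. by elim: l => //= i l IH; rewrite le_max IH orbT. Qed.

Lemma maxabs_ge u b l i : i \in l -> `|u i| <= maxabs u b l.
Proof.
elim: l => //= j l IH; rewrite inE le_max => /predU1P[->|/IH->].
  by rewrite lexx.
by rewrite orbT.
Qed.

Lemma maxabs_le u b l c : b <= c -> (forall i, i \in l -> `|u i| <= c) ->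
  maxabs u b l <= c.
Proof.
move=> bc; elim: l => //= i l IH ul; rewrite ge_max ul ?mem_head//=.
by apply: IH => j jl; apply: ul; rewrite inE jl orbT.
Qed.

Lemma maxabs_attained u b l :
  maxabs u b l = b \/ exists2 i, i \in l & maxabs u b l = `|u i|.
Proof.
elim: l => [|j l IH] /=; first by left.
case: (leP `|u j| (maxabs u b l)) => [_|_]; last first.
  by right; exists j; rewrite ?mem_head.
case: IH => [|[i il e]]; [by left|right; exists i => //].
by rewrite inE il orbT.
Qed.

Lemma maxabs_ext u u' b b' l : b = b' -> (forall i, i \in l -> u i = u' i) ->
  maxabs u b l = maxabs u' b' l.
Proof.
move=> ->; elim: l => //= i l IH ul; rewrite ul ?mem_head// IH// => j jl.
by apply: ul; rewrite inE jl orbT.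
Qed.

Lemma maxabs_continuous (S : topologicalType) (u : nat -> S -> R) (b : S -> R)
  l : continuous b -> (forall i, continuous (u i)) ->
  continuous (fun s => maxabs (u^~ s) (b s) l).
Proof.
move=> cb cu; elim: l => //= i l IH s.
apply: (@continuous_max R S (fun s => `|u i s| : R^o)
  (fun s => maxabs (u^~ s) (b s) l : R^o)); last exact: IH.
by apply: cvg_norm; exact: cu.
Qed.

(** The cube is a product of [k] parameter coordinates and [N] further ones; its missing face is the
    one where the further coordinate [c] is 0. *)
Variables k N c : nat.

Local Notation K := (Ivec * Ivec)%type.

Definition centered (x : unit_interval R) : R := 2 * \val x - 1.

(* The point projected is written in coordinates centred at 1/2 and pushed away
   from the point lying at height -1 below the centre of the missing face; the
   reciprocal of [box_gauge] is the dilation factor that reaches the box. *)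
Definition box_gauge (z : K) : R :=
  maxabs (fun i => centered (z.1 i))
    (maxabs (fun i => centered (z.2 i)) ((\val (z.2 c) + 1) / 2)
      [seq i <- iota 0 N | i != c])
    (iota 0 k).

Definition dilate (d : R) (x : unit_interval R) : unit_interval R :=
  clamp ((1 + centered x / d) / 2).

Definition box_retract (z : K) : K :=
  let d := box_gauge z in
  (fun i => if (i < k)%N then dilate d (z.1 i) else z.1 i,
   fun i => if i == c then clamp ((\val (z.2 c) + 1) / d - 1)
            else if (i < N)%N then dilate d (z.2 i) else z.2 i).

Definition in_box (z : K) : Prop :=
  (exists i e, (i < k)%N /\ onface z.1 i e) \/
  (exists i e, [/\ (i < N)%N, (i != c) || e & onface z.2 i e]).

Lemma centered_norm x : `|centered x| <= 1.
Proof. by have := val_unit x; rewrite /centered ler_norml; lra. Qed.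

(** The height term alone is at least 1/2; this makes division by the gauge continuous. *)
Lemma box_gauge_ge z : 1 / 2 <= box_gauge z.
Proof.
apply: (@le_trans _ _ ((\val (z.2 c) + 1) / 2)).
  by have := val_unit (z.2 c); lra.
by apply: le_trans (maxabs_base _ _ _); apply: maxabs_base.
Qed.

Lemma box_gauge_le z : box_gauge z <= 1.
Proof.
apply: maxabs_le => [|i _]; last exact: centered_norm.
apply: maxabs_le => [|i _]; last exact: centered_norm.
by have := val_unit (z.2 c); lra.
Qed.

Lemma onface_centered (u : Ivec) i e : onface u i e -> `|centered (u i)| = 1.
Proof.
rewrite /onface /centered => ->; case: e.
  by rewrite mulr1n (_ : _ - 1 = 1) ?normr1//; lra.
by rewrite mulr0n (_ : _ - 1 = -1) ?normrN1//; lra.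
Qed.

(** A centred coordinate has absolute value 1 on a face, and the height term [(t + 1) / 2] is 1 at
    height [t = 1]; points of the box are thus dilated by the factor 1. *)
Lemma box_gauge1 z : (c < N)%N -> in_box z -> box_gauge z = 1.
Proof.
move=> cN bz; apply/eqP; rewrite eq_le box_gauge_le /=.
case: bz => [[i [e [ik zi]]]|[i [e [iN ic zi]]]].
  rewrite -[leLHS](onface_centered zi); apply: maxabs_ge.
  by rewrite mem_iota.
apply: le_trans (maxabs_base _ _ _).
have [ice|nic] := eqVneq i c.
  apply: le_trans (maxabs_base _ _ _).
  by move: ic zi; rewrite ice eqxx /onface /= => -> ->; rewrite mulr1n; lra.
rewrite -[leLHS](onface_centered zi); apply: maxabs_ge.
by rewrite mem_filter nic mem_iota.
Qed.

Lemma dilate1 x : dilate 1 x = x.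
Proof.
rewrite -[RHS]clamp_val /dilate /centered; congr clamp; rewrite divr1; lra.
Qed.

Lemma box_retract_id z : (c < N)%N -> in_box z -> box_retract z = z.
Proof.
move=> cN bz; rewrite /box_retract (box_gauge1 cN bz).
case: z {bz} => p t /=; congr pair; apply/funext => i /=.
  by rewrite dilate1; case: ifP.
case: eqP => [->|_]; last by rewrite dilate1; case: ifP.
by rewrite -[RHS]clamp_val divr1 addrK.
Qed.

Lemma dilate_face (d : R) (x : unit_interval R) : 0 < d -> d = `|centered x| ->
  exists e : bool, \val (dilate d x) = e%:R.
Proof.
move=> d0 dx; have dn0 : d != 0 by rewrite gt_eqF.
have [x0|x0] := leP 0 (centered x).
  exists true; rewrite ger0_norm// in dx.
  by rewrite /dilate clampE -dx divff//= ?mulr1n; lra.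
exists false; rewrite ltr0_norm// in dx.
have cx : centered x = - d by rewrite dx opprK.
by rewrite /dilate cx clampE mulNr divff//= ?mulr0n; lra.
Qed.

(** The gauge is a maximum, hence attained: dilation carries a coordinate attaining it to a face,
    and if the height term attains it, the height becomes 1. *)
Lemma box_retract_face z : (c < N)%N -> in_box (box_retract z).
Proof.
move=> cN; have d0 : 0 < box_gauge z.
  by apply: lt_le_trans (box_gauge_ge z); lra.
have [|[i]] := maxabs_attained (fun i => centered (z.1 i))
  (maxabs (fun i => centered (z.2 i)) ((\val (z.2 c) + 1) / 2)
      [seq i <- iota 0 N | i != c]) (iota 0 k); last first.
  rewrite mem_iota add0n => /andP[_ ik] /(dilate_face d0)[e he].
  by left; exists i, e; rewrite /onface /= ik.
rewrite -/(box_gauge z) => dE.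
have [|[i]] := maxabs_attained (fun i => centered (z.2 i))
   ((\val (z.2 c) + 1) / 2) [seq i <- iota 0 N | i != c]; last first.
  rewrite -dE mem_filter mem_iota add0n => /and3P[ic _ iN] /(dilate_face d0)[e he].
  by right; exists i, e; rewrite /onface /= iN ic (negbTE ic).
rewrite -dE => zc; right; exists c, true; split; rewrite ?orbT//.
have zE : \val (z.2 c) = 2 * box_gauge z - 1 by rewrite zc; lra.
by rewrite /onface /= eqxx zE clampE subrK mulfK ?gt_eqF//= ?mulr1n; lra.
Qed.

Lemma box_retract_ext p t t' : (c < N)%N ->
  (forall i, (i < N)%N -> t i = t' i) ->
  (box_retract (p, t)).1 = (box_retract (p, t')).1 /\
  forall i, (i < N)%N ->
    (box_retract (p, t)).2 i = (box_retract (p, t')).2 i.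
Proof.
move=> cN tt'; have g : box_gauge (p, t) = box_gauge (p, t').
  apply: maxabs_ext => //=; apply: maxabs_ext; first by rewrite tt'.
  by move=> i; rewrite mem_filter mem_iota add0n => /and3P[_ _ /tt'->].
by split=> [|i iN] /=; rewrite ?g// iN tt'// tt'.
Qed.

Lemma continuous_affine (S : topologicalType) (u : S -> R) (a b : R) :
  continuous u -> continuous (fun s => a * u s + b).
Proof.
move=> cu s; apply: cvgD; last exact: cvg_cst.
by apply: cvgM; [exact: cvg_cst|exact: cu].
Qed.

Lemma continuous_div (S : topologicalType) (u v : S -> R) :
  continuous u -> continuous v -> (forall s, v s != 0) ->
  continuous (fun s => u s / v s).
Proof.
move=> cu cv v0 s; apply: cvgM; first exact: cu.
by apply: cvgV; [exact: v0|exact: cv].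
Qed.

Lemma continuous_comp_fun (S T U : topologicalType) (f : S -> T) (g : T -> U) :
  continuous f -> continuous g -> continuous (fun s => g (f s)).
Proof. by move=> cf cg s; apply: continuous_comp; [exact: cf|exact: cg]. Qed.

Lemma continuous_fst_snd (S T : topologicalType) :
  continuous (fun z : S * T => z.1) /\ continuous (fun z : S * T => z.2).
Proof. by split=> z; [exact: cvg_fst|exact: cvg_snd]. Qed.

Lemma centered_continuous : continuous centered.
Proof. exact: continuous_affine val_unit_continuous. Qed.

Lemma continuous_coord1 i : continuous (fun z : K => z.1 i).
Proof.
apply: (@continuous_comp_fun K Ivec _ fst (fun t => t i)).
  by case: (continuous_fst_snd Ivec Ivec).
exact: continuous_eval.
Qed.

Lemma continuous_coord2 i : continuous (fun z : K => z.2 i).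
Proof.
apply: (@continuous_comp_fun K Ivec _ snd (fun t => t i)).
  by case: (continuous_fst_snd Ivec Ivec).
exact: continuous_eval.
Qed.

Lemma height_continuous : continuous (fun z : K => \val (z.2 c) + 1).
Proof.
rewrite (_ : (fun _ => _) = fun z : K => 1 * \val (z.2 c) + 1); last first.
  by apply/funext => z; rewrite mul1r.
apply: continuous_affine.
exact: (continuous_comp_fun (@continuous_coord2 c) val_unit_continuous).
Qed.

Lemma box_gauge_continuous : continuous box_gauge.
Proof.
rewrite /box_gauge.
apply: (@maxabs_continuous K (fun i z => centered (z.1 i))); last first.
  move=> i.
  exact: (continuous_comp_fun (@continuous_coord1 i) centered_continuous).
apply: (@maxabs_continuous K (fun i z => centered (z.2 i))); last first.
  move=> i.
  exact: (continuous_comp_fun (@continuous_coord2 i) centered_continuous).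
apply: (continuous_div height_continuous) => [|_]; last by rewrite pnatr_eq0.
exact: cst_continuous.
Qed.

Lemma box_retract_continuous : continuous box_retract.
Proof.
have g0 z : box_gauge z != 0.
  by rewrite gt_eqF//; apply: lt_le_trans (box_gauge_ge z); lra.
have cdil (u : K -> unit_interval R) : continuous u ->
    continuous (fun z => dilate (box_gauge z) (u z)).
  move=> cu; rewrite /dilate.
  apply: (@continuous_comp_fun K R _ _ clamp); last exact: clamp_continuous.
  rewrite (_ : (fun _ => _) = fun z : K =>
    2^-1 * (centered (u z) / box_gauge z) + 2^-1); last first.
    by apply/funext => z; lra.
  apply: continuous_affine; apply: continuous_div => //.
    exact: (continuous_comp_fun cu centered_continuous).
  exact: box_gauge_continuous.
apply: continuous_pair; apply: continuous_into_prod => i.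
  by case: (i < k)%N => /=; [apply: cdil|]; exact: continuous_coord1.
case: (i == c) => /=; last first.
  by case: (i < N)%N => /=; [apply: cdil|]; exact: continuous_coord2.
apply: (@continuous_comp_fun K R _ _ clamp); last exact: clamp_continuous.
rewrite (_ : (fun _ => _) = fun z : K =>
  1 * ((\val (z.2 c) + 1) / box_gauge z) + -1); last first.
  by apply/funext => z; rewrite mul1r.
apply: continuous_affine.
exact: (continuous_div height_continuous box_gauge_continuous).
Qed.

End BoxRetraction.

(** * Extension of partially defined values *)

(** Recursion on [mu]: what [S] sees at [i] is masked by the default [d] at all indices whose
    measure is not smaller. The iterates of the masked [S] are stationary at [i] from step
    [mu i + 1] on. *)
Lemma measure_fix (I : Type) (V : I -> Type) (mu : I -> nat)
    (d : forall i, V i) (S : (forall i, V i) -> forall i, V i) :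
  exists W : forall i, V i,
    forall i, W i = S (fun j => if (mu j < mu i)%N then W j else d j) i.
Proof.
pose low (W : forall i, V i) i j := if (mu j < mu i)%N then W j else d j.
pose iterS := fix iterS n := if n is m.+1 then
  fun i => S (low (iterS m) i) i else d.
have stable n m i : (mu i < n)%N -> (mu i < m)%N -> iterS n i = iterS m i.
  elim: n m i => // n IH [|m] i // lt_in lt_im /=.
  congr (S _ i); apply: functional_extensionality_dep => j; rewrite /low.
  by case: ifP => // lt_ji; apply: IH; apply: leq_trans lt_ji _.
exists (fun i => iterS (mu i).+1 i) => i.
transitivity (S (low (iterS (mu i)) i) i) => //.
congr (S _ i); apply: functional_extensionality_dep => j; rewrite /low.
by case: ifP => // lt_ji; apply: stable.
Qed.

(** * Deletion and insertion of coordinates *)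

Section Coordinates.
Variable R : realType.
Local Notation K := (Ivec R * Ivec R)%type.

(** [zdrop] and [zafter] correspond to [cube_drop] and [cube_after]; the part before a cut keeps all
    coordinates, as values depend on the first ones only. [zins] inserts a 0 and so lands on the
    face on which a vertex is deleted. *)
Definition zdrop (j : nat) (z : K) : K := (z.1, fun i => z.2 (bump j i)).
Definition zafter (j : nat) (z : K) : K := (z.1, fun i => z.2 (j + i).+1).
Definition zins (j : nat) (z : K) : K :=
  (z.1, fun i => if (i < j)%N then z.2 i
                 else if i == j then clamp 0 else z.2 i.-1).

Lemma zmap_continuous (s : nat -> nat) :
  continuous (fun z : K => (z.1, fun i => z.2 (s i)) : K).
Proof.
apply: continuous_pair; first by case: (continuous_fst_snd (Ivec R) (Ivec R)).
by apply: continuous_into_prod => i; exact: continuous_coord2.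
Qed.

Lemma zdrop_continuous j : continuous (zdrop j).
Proof. exact: zmap_continuous. Qed.

Lemma zafter_continuous j : continuous (zafter j).
Proof. exact: zmap_continuous. Qed.

Lemma zins_continuous j : continuous (zins j).
Proof.
apply: continuous_pair; first by case: (continuous_fst_snd (Ivec R) (Ivec R)).
apply: continuous_into_prod => i.
case: (i < j)%N => /=; first exact: continuous_coord2.
by case: (i == j) => /=; [exact: cst_continuous|exact: continuous_coord2].
Qed.

Lemma zdropE j z i : (zdrop j z).2 i = z.2 (bump j i).
Proof. by []. Qed.

Lemma zafterE j z i : (zafter j z).2 i = z.2 (j + i).+1.
Proof. by []. Qed.

Lemma zins_bump j z i : (zins j z).2 (bump j i) = z.2 i.
Proof.
rewrite /= /bump; case: (leqP j i) => ij; last by rewrite add0n ij.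
by rewrite add1n ltnNge leqW//= eqn_leq ltnNge ij.
Qed.

Lemma zins_pos j z : onface (zins j z).2 j false.
Proof. by rewrite /onface /= ltnn eqxx clampE ?lexx ?ler01. Qed.

Lemma zdrop_ins j z : zdrop j (zins j z) = z.
Proof.
case: z => p t; congr pair; apply/funext => i.
exact: (zins_bump j (p, t)).
Qed.

Lemma zins_lt j z i : (i < j)%N -> (zins j z).2 i = z.2 i.
Proof. by move=> /= ->. Qed.

Lemma zdrop_lt j z i : (i < j)%N -> (zdrop j z).2 i = z.2 i.
Proof. by move=> ij; rewrite zdropE /bump leqNgt ij. Qed.

Lemma zdrop_drop i j z : (i < j)%N ->
  zdrop j.-1 (zdrop i z) = zdrop i (zdrop j z).
Proof.
move=> ij; congr pair; apply/funext => l /=; congr (z.2 _).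
by rewrite /bump; lia.
Qed.

Lemma zafter_drop_gt i j z : (i < j)%N ->
  zafter i (zdrop j z) = zdrop (j - i.+1) (zafter i z).
Proof.
move=> ij; congr pair; apply/funext => l /=; congr (z.2 _).
by rewrite /bump; lia.
Qed.

Lemma zafter_drop_le i j z : (i <= j)%N ->
  zafter j (zdrop i z) = zafter j.+1 z.
Proof.
move=> ij; congr pair; apply/funext => l /=; congr (z.2 _).
by rewrite /bump; lia.
Qed.

Lemma zdrop_zins i j z : (i < j)%N ->
  zdrop i (zins j z) = zins j.-1 (zdrop i z).
Proof.
move=> ij; congr pair; apply/funext => l /=; rewrite /bump.
have -> : ((i <= l)%N + l == j)%N = (l == j.-1)%N by lia.
have -> : ((i <= l)%N + l < j)%N = (l < j.-1)%N by lia.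
case: ltnP => // jl; case: eqP => // /eqP nlj; congr (z.2 _); lia.
Qed.

Lemma zafter_after i j z : zafter j (zafter i z) = zafter (i + j).+1 z.
Proof.
congr pair; apply/funext => l /=; congr (z.2 _).
by lia.
Qed.

End Coordinates.

Section MergeAt.
Variable Y : category.

Definition mergeat (A B : Y) (c : route A B) (j : nat) : route A B :=
  if dec c j is Some y then cmerge y else c.

Lemma mergeat_cat (A X B : Y) (a : route A X) (b : route X B) :
  mergeat (rcat a b) (rsize a) = rmerge a b.
Proof. by rewrite /mergeat dec_cat. Qed.

Lemma rsize_mergeat (A B : Y) (c : route A B) j : (j < rsize c)%N ->
  (rsize (mergeat c j)).+1 = rsize c.
Proof.
by move=> /dec_split[x [dx -> <-]]; rewrite mergeat_cat rsize_merge rsize_cat.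
Qed.

(** The vertex at [j] moves to [j.-1] once the earlier vertex is deleted; the rest is associativity
    of merging three pieces. *)
Lemma mergeat_comm (A B : Y) (c : route A B) i j : (i < j < rsize c)%N ->
  mergeat (mergeat c j) i = mergeat (mergeat c i) j.-1.
Proof.
move=> /triple_cut[X1 [X2 [d1 [d2 [d3 [-> <- ->]]]]]] /=.
rewrite mergeat_cat -rcatA -rsize_cat mergeat_cat rmerge_catl mergeat_cat.
by rewrite -rcat_mergel -rsize_merge mergeat_cat rmergeA.
Qed.

Lemma triple_cut_mergeat (A B : Y) (c : route A B) i j : (i < j < rsize c)%N ->
  exists X1 X2 (d1 : route A X1) (d2 : route X1 X2) (d3 : route X2 B),
  [/\ c = rcat d1 (rcat d2 d3), rsize d1 = i & j = (i + rsize d2).+1] /\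
  [/\ dec c i = Some (Cut d1 (rcat d2 d3)),
      dec c j = Some (Cut (rcat d1 d2) d3),
      mergeat c i = rcat (rmerge d1 d2) d3 &
      mergeat c j = rcat d1 (rmerge d2 d3)].
Proof.
move=> /triple_cut[X1 [X2 [d1 [d2 [d3 [ex d1i d2j]]]]]].
exists X1, X2, d1, d2, d3; split=> //; rewrite ex; split.
- by rewrite -d1i dec_cat.
- by rewrite -rcatA d2j -d1i -rsize_cat dec_cat.
- by rewrite -d1i mergeat_cat rcat_mergel.
- by rewrite -rcatA d2j -d1i -rsize_cat mergeat_cat rmerge_catl.
Qed.

End MergeAt.

(** * The inductive construction of the extension *)

Section Core.
Variables (R : realType) (C : continuous_category) (Y : category).
Variables (O : Y -> C) (lev : Y -> nat).
Hypothesis lev_mono : forall A B : Y, hom B A -> (lev A <= lev B)%N.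
Local Notation K := (Ivec R * Ivec R)%type.

(** Sequences between such ends spread over at most one step of the level; their values are
    prescribed by [g]. *)
Definition small (A B : Y) : bool := (lev B <= (lev A).+1)%N.

Definition values := forall A B : Y, route A B -> K -> chom (O A) (O B).

Definition compose_at (F : values) (A B : Y) (y : cut A B) (z : K) :
    chom (O A) (O B) :=
  ccomp (F _ _ (cright y) (zafter (rsize (cleft y)) z)) (F _ _ (cleft y) z).

Definition finitary (A B : Y) (m : nat) (f : K -> chom (O A) (O B)) :=
  forall p t t', (forall i, (i < m)%N -> t i = t' i) -> f (p, t) = f (p, t').

(** A family of flexible functors parametrised by the first component of [K]. Only the cubical laws
    are listed: the unit law concerns equal ends, hence a small pair, and is inherited from the
    prescribed values. *)
Record regular (F : values) : Prop := Regular {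
  regular_continuous : forall A B (c : route A B), continuous (F _ _ c);
  regular_finitary : forall A B (c : route A B), finitary (rsize c) (F _ _ c);
  regular_law1 : forall A B (y : cut A B) z,
    onface z.2 (rsize (cleft y)) true -> F _ _ (ccat y) z = compose_at F y z;
  regular_law0 : forall A B (y : cut A B) z,
    onface z.2 (rsize (cleft y)) false ->
    F _ _ (ccat y) z = F _ _ (cmerge y) (zdrop (rsize (cleft y)) z)
}.

Lemma regular_mergeat (F : values) (A B : Y) (c : route A B) j z : regular F ->
  (j < rsize c)%N -> onface z.2 j false ->
  F _ _ c z = F _ _ (mergeat c j) (zdrop j z).
Proof.
by move=> rF /dec_split[y [_ -> <-]] /(regular_law0 rF)->; rewrite mergeat_cat.
Qed.

Variable g : forall A B : Y, small A B -> route A B -> K -> chom (O A) (O B).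
Hypothesis g_continuous : forall A B (e : small A B) c, continuous (g e c).
Hypothesis g_finitary : forall A B (e : small A B) c,
  finitary (rsize c) (g e c).
Hypothesis g_law1 : forall A B (e : small A B) (y : cut A B)
    (el : small A (cmid y)) (er : small (cmid y) B) z,
  onface z.2 (rsize (cleft y)) true ->
  g e (ccat y) z =
  ccomp (g er (cright y) (zafter (rsize (cleft y)) z)) (g el (cleft y) z).
Hypothesis g_law0 : forall A B (e : small A B) (y : cut A B) z,
  onface z.2 (rsize (cleft y)) false ->
  g e (ccat y) z = g e (cmerge y) (zdrop (rsize (cleft y)) z).

(** The data on the boundary of the parameter cube: one family for each face [i], [e], defined for
    all parameters and to be matched on that face. *)
Variables (k : nat) (h : 'I_k -> bool -> values).
Hypothesis h_regular : forall i e, regular (h i e).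
Hypothesis h_small : forall i e A B (s : small A B) (c : route A B) z,
  h i e c z = g s c z.
Hypothesis h_overlap : forall (i i' : 'I_k) e e' (A B : Y) (c : route A B) z,
  onface z.1 i e -> onface z.1 i' e' -> h i e c z = h i' e' c z.

Variable cutof : forall A B : Y, ~~ small A B -> route A B -> cut A B.

(** The marked vertex is the last one on the level just above [lev A], so every unmarked vertex of
    that level lies in the left half. *)
Definition good (A B : Y) (x : cut A B) : Prop :=
  [/\ lev (cmid x) = (lev A).+1, (lev (cmid x) < lev B)%N &
      rcount (fun X => lev X == (lev A).+1) (cright x) = 0%N].

Hypothesis cutof_good : forall A B (ns : ~~ small A B) c, good (cutof ns c).
Hypothesis cutof_merge : forall A B (ns : ~~ small A B) c,
  cmerge (cutof ns c) = c.
(** Deleting an unmarked vertex before the marked one has to lead to the cut chosen for the smaller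
    sequence; [plain_ok] relies on this when the mark survives. *)
Hypothesis cutof_left : forall A B (ns : ~~ small A B) c
    (y : cut A (cmid (cutof ns c))),
  cutof ns (rmerge (cmerge y) (cright (cutof ns c))) =
  Cut (cmerge y) (cright (cutof ns c)).

(** Fills the branches that do not occur on the box; it has to be supplied, since a morphism space
    may be empty. *)
Variable dflt : forall A B : Y, route A B -> chom (O A) (O B).

Definition fillers := forall A B : Y, cut A B -> K -> chom (O A) (O B).

(** For a large pair the value is read off from the filler on the missing face, where the coordinate
    of the inserted vertex is 0. *)
Definition value_of (W : fillers) : values := fun A B c z =>
  match boolP (small A B) with
  | AltTrue e => g e c z
  | AltFalse ns =>
    W _ _ (cutof ns c) (zins (rsize (cleft (cutof ns c))) z)
  end.

(* A cell is either a sequence [c] or, for [x : cut A B], the sequence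
   [ccat x] with the vertex [cmid x] marked.  The values on the marked cells
   are auxiliary: the face on which the marked vertex is deleted is the value on
   the plain cell [cmerge x]. *)
Inductive cell (A B : Y) := Plain of route A B | Marked of cut A B.

Definition under (A B : Y) (G : cell A B) : route A B :=
  match G with Plain c => c | Marked x => ccat x end.

Definition cell_value (W : fillers) (A B : Y) (G : cell A B) :=
  match G with Plain c => value_of W c | Marked x => W _ _ x end.

Definition inner_face (A B : Y) (G : cell A B) (j : nat) : bool :=
  if G is Marked x then j != rsize (cleft x) else true.

(** Deleting an unmarked vertex of level [lev A + 1] leaves as many vertices as in [cmerge x], and
    as many on that level. The resulting plain cell would not have smaller weight, so the mark is
    kept in this case. *)
Definition cell_face (A B : Y) (G : cell A B) (j : nat) : cell A B :=
  match G with
  | Plain c => Plain (mergeat c j)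
  | Marked x =>
    if dec (cleft x) j is Some y then
      if lev (cmid y) == (lev A).+1 then Marked (Cut (cmerge y) (cright x))
      else Plain (mergeat (ccat x) j)
    else Plain (mergeat (ccat x) j)
  end.

(* Decreases when a vertex is deleted, when a vertex off the level [lev A + 1]
   is traded for one on that level, and when the span [lev B - lev A] drops. *)
Definition weight (A B : Y) (c : route A B) : nat :=
  ((lev B - lev A).+1 * (rsize c).+2
   - rcount (fun X => lev X == (lev A).+1) c)%N.

Definition cell_weight (A B : Y) (G : cell A B) : nat :=
  match G with Plain c => weight c | Marked x => weight (cmerge x) end.

Definition good_cell (A B : Y) (G : cell A B) : Prop :=
  if G is Marked x then good x else True.

Lemma dec_cleft (A B : Y) (x : cut A B) j : (j < rsize (cleft x))%N ->
  exists y : cut A (cmid x),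
    [/\ dec (cleft x) j = Some y, cleft x = ccat y, rsize (cleft y) = j &
        dec (ccat x) j = Some (Cut (cleft y) (rcat (cright y) (cright x)))].
Proof.
move=> jx; have [y [dy ey yj]] := dec_split jx.
by exists y; split=> //; rewrite /ccat dec_cat_l// dy.
Qed.

Lemma under_face (A B : Y) (G : cell A B) j :
  (j < rsize (under G))%N -> inner_face G j ->
  under (cell_face G j) = mergeat (under G) j.
Proof.
case: G => //= x jx jc; case: (ltnP j (rsize (cleft x))) => jl.
  have [y [-> ey yj dy]] := dec_cleft jl; case: ifP => //= _.
  by rewrite /mergeat dy /ccat /= rcat_mergel.
by rewrite dec_None.
Qed.

Lemma cell_face_inner (A B : Y) (G : cell A B) i j :
  (i < j < rsize (under G))%N -> inner_face G i -> inner_face G j ->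
  inner_face (cell_face G j) i /\ inner_face (cell_face G i) j.-1.
Proof.
case: G => //= x /andP[ij jx] ic jc; split.
  case: (ltnP j (rsize (cleft x))) => jl; last by rewrite dec_None.
  have [y [-> ey yj dy]] := dec_cleft jl; case: ifP => //= _.
  by move: jl; rewrite /cmerge ey /ccat rsize_cat rsize_merge; lia.
case: (ltnP i (rsize (cleft x))) => il; last by rewrite dec_None.
have [y [-> ey yj dy]] := dec_cleft il; case: ifP => //= _.
by move: jc; rewrite /cmerge ey /ccat rsize_cat rsize_merge; lia.
Qed.

(** On underlying sequences this is [mergeat_comm]. Both orders also treat the mark alike: it
    survives exactly if both deleted vertices lie before it on level [lev A + 1]. *)
Lemma cell_face_comm (A B : Y) (G : cell A B) i j :
  (i < j < rsize (under G))%N -> inner_face G i -> inner_face G j ->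
  cell_face (cell_face G j) i = cell_face (cell_face G i) j.-1.
Proof.
case: G => /= [c ij _ _|x /andP[ij jx] ic jc]; first by rewrite mergeat_comm.
have mc : mergeat (mergeat (ccat x) j) i = mergeat (mergeat (ccat x) i) j.-1.
  by rewrite mergeat_comm// ij.
case: (ltnP j (rsize (cleft x))) => jl; last first.
  rewrite [dec _ j]dec_None//=.
  case: (ltnP i (rsize (cleft x))) => il; last by rewrite dec_None//= mc.
  have [y [-> ey yi dy]] := dec_cleft il; case: ifP => //= _; rewrite ?mc//.
  have u : ccat (Cut (cmerge y) (cright x)) = mergeat (ccat x) i.
    by rewrite /mergeat dy /ccat /= rcat_mergel.
  rewrite dec_None; first by rewrite u.
  by move: jc jl; rewrite /cmerge ey /ccat rsize_cat rsize_merge; lia.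
have [|X1 [X2 [d1 [d2 [d3 [ex d1i d2j]]]]]] := @triple_cut _ _ _ (cleft x) i j.
  by rewrite ij.
have e1 : dec (cleft x) i = Some (Cut d1 (rcat d2 d3)).
  by rewrite ex -d1i dec_cat.
have e2 : dec (cleft x) j = Some (Cut (rcat d1 d2) d3).
  by rewrite ex -rcatA d2j -d1i -rsize_cat dec_cat.
rewrite e1 e2 /=.
have u1 : ccat (Cut (rmerge d1 (rcat d2 d3)) (cright x)) = mergeat (ccat x) i.
  by rewrite /ccat /= ex rcatA -d1i mergeat_cat rcat_mergel.
have u2 : ccat (Cut (rmerge (rcat d1 d2) d3) (cright x)) = mergeat (ccat x) j.
  rewrite /ccat /= ex -!rcatA d2j -d1i -rsize_cat rcatA mergeat_cat.
  by rewrite rcat_mergel.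
have f1 : dec (rmerge d1 (rcat d2 d3)) j.-1 = Some (Cut (rmerge d1 d2) d3).
  by rewrite -rcat_mergel d2j -d1i -rsize_merge dec_cat.
have f2 : dec (rmerge (rcat d1 d2) d3) i = Some (Cut d1 (rmerge d2 d3)).
  by rewrite rmerge_catl -d1i dec_cat.
rewrite /cmerge /=.
case: eqP => E1; case: eqP => E2 /=; rewrite ?f1 ?f2 /= ?u1 ?u2 ?mc //=.
- by case: eqP => //; case: eqP => // _ _; rewrite /cmerge /= rmergeA.
- by case: eqP => //; rewrite u2 mc.
- by case: eqP => //; rewrite u1 -mc.
Qed.

Lemma good_left_lev (A B : Y) (x : cut A B) (y : cut A (cmid x)) : good x ->
  (lev A <= lev (cmid y) <= (lev A).+1)%N.
Proof.
by case=> <- _ _;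
  rewrite !(route_le lev_mono (cleft y), route_le lev_mono (cright y)).
Qed.

(** A piece from [A] or to [B] may have as many vertices as [cmerge x] if it contains the marked
    vertex, but then either its span is smaller or it has one more vertex on level [lev A + 1]. A
    right piece starting above [lev A] has a smaller span. *)
Lemma weight_pieces (A B : Y) (x y : cut A B) : good x -> ccat y = ccat x ->
  (weight (cleft y) < weight (cmerge x))%N /\
  (weight (cright y) < weight (cmerge x))%N.
Proof.
move=> gx; have [lM lB cb] := gx.
have ca := rcount_le (fun X => lev X == (lev A).+1) (cleft x).
(* Naming the span [D] keeps truncated subtraction out of the nonlinear arithmetic; [D] is at least
   2 because level [lev A + 1] lies strictly below [B]. *)
have [D DE D2] : exists2 D, lev B = (lev A + D)%N & (2 <= D)%N.
  by exists (lev B - lev A)%N; lia.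
case/ccat_eq_ccat => [[u [ux ->]]|->|[u [ux ->]]].
- have lu := good_left_lev u gx;
    have cu := rcount_le (fun X => lev X == (lev A).+1).
  rewrite /weight /cmerge rsize_merge rcount_merge cb -ux /ccat /= !rsize_cat.
  rewrite !rcount_cat lM DE.
  have c1 := cu _ _ (cleft u); have c2 := cu _ _ (cright u).
  split; first nia.
  have [e|ne] := eqVneq (lev (cmid u)) (lev A); first by rewrite e eqxx cb; nia.
  have -> : lev (cmid u) = (lev A).+1 by lia.
  by rewrite eqxx; nia.
- rewrite /weight /cmerge rsize_merge rcount_merge cb lM DE.
  by split; nia.
- have lu := route_le lev_mono (cleft u);
    have lu' := route_le lev_mono (cright u).
  move: cb; rewrite /weight /cmerge rsize_merge rcount_merge -ux /ccat /=.
  rewrite !rsize_cat !rcount_cat lM eqxx; rewrite {}DE in lB lu' *.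
  have [E EE] : exists E, lev (cmid u) = (lev A + E)%N.
    by exists (lev (cmid u) - lev A)%N; lia.
  rewrite {}EE {}lM in lu lu' *.
  by case: eqP => /= ne cb; split; nia.
Qed.

(** If the mark survives, [cmerge] loses a vertex. Otherwise the new sequence has as many vertices
    as [cmerge x], but the formerly marked vertex is one more on level [lev A + 1]. *)
Lemma weight_face (A B : Y) (x : cut A B) j : good x ->
  (j < rsize (ccat x))%N -> j != rsize (cleft x) ->
  (cell_weight (cell_face (Marked x) j) < weight (cmerge x))%N /\
  good_cell (cell_face (Marked x) j).
Proof.
move=> gx jx nj; have [lM lB cb] := gx.
have [D DE D2] : exists2 D, lev B = (lev A + D)%N & (2 <= D)%N.
  by exists (lev B - lev A)%N; lia.
have [y [dy ey yj]] := dec_split jx.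
case/esym/ccat_eq_ccat: ey dy yj => [[u [ux ->]]|yx|[u [ux ->]]] dy yj.
- move: yj => /= uj; rewrite /= -ux -uj dec_ccat; case: eqP => lu /=;
    last first.
    rewrite uj /mergeat dy; split=> //.
    rewrite /weight /cmerge !rsize_merge !rcount_merge /= rsize_cat rcount_cat.
    rewrite cb -ux /ccat !rsize_cat !rcount_cat lM eqxx;
      move/eqP/negbTE: lu => ->.
    have := rcount_le (fun X => lev X == (lev A).+1) (cleft u).
    have := rcount_le (fun X => lev X == (lev A).+1) (cright u).
    by rewrite DE; nia.
  split; last by split.
  rewrite /weight /cmerge !rsize_merge !rcount_merge /= cb -ux /ccat.
  rewrite !rsize_cat !rcount_cat lu eqxx.
  have := rcount_le (fun X => lev X == (lev A).+1) (cleft u).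
  have := rcount_le (fun X => lev X == (lev A).+1) (cright u).
  by rewrite DE; nia.
- by move: yj nj; rewrite yx => ->; rewrite eqxx.
- move: yj => /= uj; rewrite /= dec_None; last by rewrite -uj rsize_cat; lia.
  rewrite /= /mergeat dy; split=> //.
  move: cb; rewrite /weight /cmerge !rsize_merge !rcount_merge /= rsize_cat.
  rewrite rcount_cat -ux /ccat !rsize_cat !rcount_cat lM eqxx.
  have := rcount_le (fun X => lev X == (lev A).+1) (cleft x).
  by case: eqP => // lu cx cb; rewrite DE; nia.
Qed.

(** The invariant of the induction. The law at 0 leaves out the missing face, on which the marked
    vertex is deleted; the law at 1 includes the cut at the marked vertex. *)
Record cell_ok (W : fillers) (A B : Y) (G : cell A B) : Prop := CellOk {
  ok_continuous : continuous (cell_value W G);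
  ok_finitary : finitary (rsize (under G)) (cell_value W G);
  ok_param : forall (i : 'I_k) e z, onface z.1 i e ->
    cell_value W G z = h i e (under G) z;
  ok_law1 : forall (y : cut A B) z, ccat y = under G ->
    onface z.2 (rsize (cleft y)) true ->
    cell_value W G z = compose_at (value_of W) y z;
  ok_law0 : forall j z, (j < rsize (under G))%N -> inner_face G j ->
    onface z.2 j false ->
      cell_value W G z = cell_value W (cell_face G j) (zdrop j z)
}.

Lemma ok_law1_plain (W : fillers) (A B : Y) (y : cut A B) z :
  cell_ok W (Plain (ccat y)) -> onface z.2 (rsize (cleft y)) true ->
  value_of W (ccat y) z = compose_at (value_of W) y z.
Proof. by move=> ok; exact: (ok_law1 ok). Qed.

Lemma ok_law0_plain (W : fillers) (A B : Y) (y : cut A B) z :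
  cell_ok W (Plain (ccat y)) -> onface z.2 (rsize (cleft y)) false ->
  value_of W (ccat y) z = value_of W (cmerge y) (zdrop (rsize (cleft y)) z).
Proof.
move=> ok /(ok_law0 ok) /= ->//; last by rewrite /ccat rsize_cat; lia.
by rewrite mergeat_cat.
Qed.

Lemma ok_finitary_plain (W : fillers) (A B : Y) (c : route A B) z z' :
  cell_ok W (Plain c) -> z.1 = z'.1 ->
  (forall i, (i < rsize c)%N -> z.2 i = z'.2 i) ->
  value_of W c z = value_of W c z'.
Proof. by case: z z' => p t [p' t'] ok /= -> tt'; exact: (ok_finitary ok). Qed.

Lemma value_of_small (W : fillers) (A B : Y) (s : small A B) (c : route A B) :
  value_of W c = g s c.
Proof.
apply/funext => z; rewrite /value_of; case: {-}_ / boolP => [s'|ns].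
  by rewrite (bool_irrelevance s' s).
by case/negP: (ns).
Qed.

Lemma value_of_large (W : fillers) (A B : Y) (ns : ~~ small A B) (c :
  route A B) :
  value_of W c =
  fun z => W _ _ (cutof ns c) (zins (rsize (cleft (cutof ns c))) z).
Proof.
apply/funext => z; rewrite /value_of; case: {-}_ / boolP => [s|ns'].
  by case/negP: (ns).
by rewrite (bool_irrelevance ns' ns).
Qed.

Lemma small_cut (A B : Y) (y : cut A B) : small A B ->
  small A (cmid y) /\ small (cmid y) B.
Proof.
have := route_le lev_mono (cleft y); have := route_le lev_mono (cright y).
by rewrite /small; lia.
Qed.

Lemma small_ok (W : fillers) (A B : Y) (c : route A B) :
  small A B -> cell_ok W (Plain c).
Proof.
move=> s; split=> /=; rewrite ?(value_of_small W s).
- exact: g_continuous.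
- exact: g_finitary.
- by move=> i e z _; rewrite (h_small i e s).
- move=> y z <- zy; have [sl sr] := small_cut y s.
  by rewrite (g_law1 s sl sr zy) /compose_at !value_of_small.
- move=> j z /dec_split[y [_ -> <-]] _ /(g_law0 s)->.
  by rewrite mergeat_cat value_of_small.
Qed.

Definition face_index (A B : Y) (x : cut A B) : finType :=
  (('I_k * bool) + ('I_(rsize (ccat x)) * bool))%type.

Definition on_face (A B : Y) (x : cut A B)
    (f : face_index x) (z : K) : Prop :=
  match f with
  | inl ie => onface z.1 ie.1 ie.2
  | inr je => (nat_of_ord je.1 != rsize (cleft x)) || je.2 /\
              onface z.2 je.1 je.2
  end.

Definition face_value (W : fillers) (A B : Y) (x : cut A B)
    (f : face_index x) (z : K) :
    chom (O A) (O B) :=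
  match f with
  | inl ie => h ie.1 ie.2 (ccat x) z
  | inr (j, true) =>
    if dec (ccat x) j is Some y then compose_at (value_of W) y z
    else dflt (ccat x)
  | inr (j, false) => cell_value W (cell_face (Marked x) j) (zdrop j z)
  end.

Lemma onface_inj (u : Ivec R) i e e' : onface u i e -> onface u i e' -> e = e'.
Proof.
rewrite /onface => -> /eqP; rewrite eqr_nat.
by case: e; case: e'.
Qed.

(** * Agreement of the face values where faces meet *)

Section Compatibility.
Variables (W : fillers) (A B : Y) (x : cut A B).
Hypothesis gx : good x.
Hypothesis IH : forall (A' B' : Y) (G : cell A' B'), good_cell G ->
  (cell_weight G < weight (cmerge x))%N -> cell_ok W G.

Let pieces_ok (y : cut A B) : ccat y = ccat x ->
  cell_ok W (Plain (cleft y)) /\ cell_ok W (Plain (cright y)).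
Proof. by case/(weight_pieces gx) => wl wr; split; apply: IH. Qed.

Let face_ok j : (j < rsize (ccat x))%N -> j != rsize (cleft x) ->
  cell_ok W (cell_face (Marked x) j).
Proof. by move=> jx /(weight_face gx jx)[wj gj]; exact: IH. Qed.

Lemma face_value_param (f : 'I_(rsize (ccat x)) * bool) (i : 'I_k) e z :
  onface z.1 i e -> on_face (inr f) z ->
  face_value W (inr f) z = h i e (ccat x) z.
Proof.
case: f => j [] zi /= [jx zj].
  have [y [-> ey yj]] := dec_split (ltn_ord j).
  have [okl okr] := pieces_ok (esym ey).
  rewrite ey (regular_law1 (h_regular i e)) ?yj// /compose_at.
  have /= -> // := ok_param okl zi.
  by have /= <- // := ok_param okr (z := zafter (rsize (cleft y)) z) zi.
rewrite orbF in jx; rewrite (ok_param (face_ok _ jx) (z := zdrop j z) zi)//.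
by rewrite under_face//= -(regular_mergeat (h_regular i e)).
Qed.

(** If both coordinates are 1, this is associativity of composition; if both are 0, commutation of
    the two deletions. In the mixed cases the law at 1 splits the value on the smaller cell, and the
    law at 0 is applied to the piece containing the deleted vertex. *)
Lemma face_value_lt (f f' : 'I_(rsize (ccat x)) * bool) z : (f.1 < f'.1)%N ->
  on_face (inr f) z -> on_face (inr f') z ->
  face_value W (inr f) z = face_value W (inr f') z.
Proof.
case: f f' => i e [j e'] /= ij [ix zi] [jx zj].
have ijx : (i < j < rsize (ccat x))%N by rewrite ij ltn_ord.
have [X1 [X2 [d1 [d2 [d3 [[ex d1i d2j] [di dj mi mj]]]]]]] :=
  triple_cut_mergeat ijx.
have [ok1 ok23] : cell_ok W (Plain d1) /\ cell_ok W (Plain (rcat d2 d3)).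
  by apply: (pieces_ok (y := Cut d1 (rcat d2 d3))); rewrite [RHS]ex.
have [ok12 ok3] : cell_ok W (Plain (rcat d1 d2)) /\ cell_ok W (Plain d3).
  by apply: (pieces_ok (y := Cut (rcat d1 d2) d3)); rewrite [RHS]ex -rcatA.
have bji : bump j i = i by rewrite /bump; lia.
have bij : bump i j.-1 = j by rewrite /bump; lia.
have zi2 (e2 : bool) : onface z.2 j e2 -> onface (zafter i z).2 (rsize d2) e2.
  by rewrite /onface zafterE -d2j.
case: e e' => [] [] in ix jx zi zj *.
- rewrite di dj /compose_at /= rsize_cat d1i -d2j.
  rewrite (ok_law1_plain (y := Cut d2 d3) ok23)/=; last exact: zi2.
  rewrite (ok_law1_plain (y := Cut d1 d2) ok12)/= ?d1i//.
  by rewrite /compose_at /= zafter_after -d2j d1i ccompA.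
- rewrite orbF in jx; rewrite di.
  rewrite (ok_law1 (face_ok (ltn_ord j) jx) (y := Cut d1 (rmerge d2 d3)))/=.
  + rewrite /compose_at /= d1i; congr ccomp.
      rewrite (ok_law0_plain (y := Cut d2 d3) ok23)/=; last exact: zi2.
      by rewrite zafter_drop_gt// d2j subSS addKn.
    by apply: (ok_finitary_plain ok1) => // l; rewrite d1i => /ltn_trans l_lt;
      rewrite zdrop_lt// l_lt.
  + by rewrite (under_face (G := Marked x))//= mj.
  + by rewrite d1i /onface /= bji.
- rewrite orbF in ix; rewrite dj.
  rewrite (ok_law1 (face_ok (ltn_ord i) ix) (y := Cut (rmerge d1 d2) d3))/=.
  + rewrite /compose_at /= rsize_cat rsize_merge d1i; congr ccomp.
      by rewrite zafter_drop_le// leq_addr.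
    rewrite (ok_law0_plain (y := Cut d1 d2) ok12)/= ?d1i//.
  + by rewrite (under_face (G := Marked x))//= mi.
  + have -> : rsize (rmerge d1 d2) = j.-1 by rewrite rsize_merge d1i d2j.
    by rewrite /onface /= bij.
- rewrite !orbF in ix jx.
  have [fi fj] := cell_face_inner (G := Marked x) ijx ix jx.
  have si : rsize (mergeat (ccat x) i) = (rsize (ccat x)).-1.
    exact: (congr1 predn (rsize_mergeat (ltn_ord i))).
  have sj : rsize (mergeat (ccat x) j) = (rsize (ccat x)).-1.
    exact: (congr1 predn (rsize_mergeat (ltn_ord j))).
  rewrite (ok_law0 (face_ok (ltn_ord i) ix) (j := j.-1))//.
  + rewrite (ok_law0 (face_ok (ltn_ord j) jx) (j := i))//.
    * by rewrite -(cell_face_comm (G := Marked x))// zdrop_drop.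
    * by rewrite (under_face (G := Marked x))//= sj; lia.
    * by rewrite /onface /= bji.
  + by rewrite (under_face (G := Marked x))//= si; lia.
  + by rewrite /onface /= bij.
Qed.

Lemma face_value_compat (f f' : face_index x)
    z : on_face f z -> on_face f' z -> face_value W f z = face_value W f' z.
Proof.
case: f f' => [[i e]|f] [[i' e']|f'] zf zf'.
- exact: h_overlap zf zf'.
- by rewrite (@face_value_param f' i e).
- by rewrite (@face_value_param f i' e').
- have [lt|lt|eq_ff] := ltngtP f.1 f'.1.
  + exact: face_value_lt.
  + by apply/esym; exact: face_value_lt.
  + case: f f' zf zf' eq_ff => [j e] [j' e'] /= [_ zj] [_ zj'] /val_inj jj.
    by move: zj'; rewrite -jj => /(onface_inj zj) <-.
Qed.

Lemma compose_at_continuous (y : cut A B) : ccat y = ccat x ->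
  continuous (compose_at (value_of W) y).
Proof.
move=> /pieces_ok[okl okr].
apply: (continuous_comp_fun _ (@ccomp_continuous C _ _ _)
  (f := fun z => (_, _))).
apply: continuous_pair; last exact: (ok_continuous okl).
apply: (continuous_comp_fun _ (ok_continuous okr)).
exact: zafter_continuous.
Qed.

Lemma face_value_continuous (f : face_index x)
    z : on_face f z -> continuous (face_value W f).
Proof.
case: f => [[i e] _|[j []] /= [jx _]] /=.
- exact: (regular_continuous (h_regular i e)).
- have [y [dy /esym ey _]] := dec_split (ltn_ord j).
  rewrite (_ : face_value _ _ = compose_at (value_of W) y); last first.
    by apply/funext => z' /=; rewrite dy.
  exact: compose_at_continuous.
- rewrite orbF in jx.
  apply: (continuous_comp_fun _ (ok_continuous (face_ok (ltn_ord j) jx))).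
  exact: zdrop_continuous.
Qed.

Lemma face_value_finitary
    (f : face_index x) z :
  on_face f z -> finitary (rsize (ccat x)) (face_value W f).
Proof.
case: f => [[i e] _|[j []] /= [jx _]] p t t' tt' /=.
- exact: (regular_finitary (h_regular i e)).
- have [y [-> /esym ey yj]] := dec_split (ltn_ord j).
  have [okl okr] := pieces_ok ey; rewrite /compose_at.
  have sx : rsize (ccat x) = (rsize (cleft y) + rsize (cright y)).+1.
    by rewrite -ey rsize_cat.
  congr ccomp.
    by apply: (ok_finitary_plain okr) => //= i iy; apply: tt'; rewrite sx; lia.
  by apply: (ok_finitary_plain okl) => //= i iy; apply: tt'; rewrite sx; lia.
- rewrite orbF in jx; apply: (ok_finitary (face_ok (ltn_ord j) jx)) => /= i.
  rewrite (under_face (G := Marked x))//= => ij; apply: tt'.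
  by have := rsize_mergeat (ltn_ord j); rewrite /bump; lia.
Qed.

End Compatibility.

(** The face is picked arbitrarily; [face_value_compat] makes the choice immaterial once the cells
    of smaller weight are settled. *)
Definition filler_of (W : fillers) : fillers := fun A B x z =>
  if [pick f : face_index x | `[< on_face f z >]] is Some f
  then face_value W f z else dflt (ccat x).

Lemma in_boxP (A B : Y) (x : cut A B) z :
  in_box k (rsize (ccat x)) (rsize (cleft x)) z <->
  exists f : face_index x, on_face f z.
Proof.
split=> [[[i [e [ik zi]]]|[i [e [ix ic zi]]]]|[[[i e]|[j e]] /=]].
- by exists (inl (Ordinal ik, e)).
- by exists (inr (Ordinal ix, e)).
- by move=> zi; left; exists i, e.
- by move=> [jx zj]; right; exists j, e.
Qed.

(** * Regularity of a solution of the recursion *)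

Section Solution.
Variable W : fillers.
Hypothesis WE : forall A B (x : cut A B), good x -> forall z,
  W x z = filler_of W x (box_retract k (rsize (ccat x)) (rsize (cleft x)) z).

Lemma cleft_lt (A B : Y) (x : cut A B) : (rsize (cleft x) < rsize (ccat x))%N.
Proof. by rewrite rsize_cat; lia. Qed.

(** The retraction fixes the box, so [W] takes the face values there, which gives the laws.
    Continuity follows by pasting over the preimages of the faces under the retraction. *)
Lemma marked_ok (A B : Y) (x : cut A B) : good x ->
  (forall (A' B' : Y) (G : cell A' B'), good_cell G ->
    (cell_weight G < weight (cmerge x))%N -> cell_ok W G) ->
  cell_ok W (Marked x).
Proof.
move=> gx IH;
  pose r := box_retract (R := R) k (rsize (ccat x)) (rsize (cleft x)).
have WF (f : face_index x) z : on_face f (r z) -> W x z = face_value W f (r z).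
  move=> fz; rewrite WE// /filler_of; case: pickP => [f' /asboolP f'z|/(_ f)].
    exact: face_value_compat.
  by move/asboolP.
have rid (f : face_index x) z : on_face f z -> r z = z.
  by move=> fz; apply: box_retract_id (cleft_lt x) _; apply/in_boxP; exists f.
have WF' (f : face_index x) z : on_face f z -> W x z = face_value W f z.
  by move=> fz; rewrite (WF f) (rid f z fz).
have cov z : exists f : face_index x, on_face f (r z).
  by apply/in_boxP/box_retract_face/cleft_lt.
have rc : continuous r by exact: box_retract_continuous.
have c1 i : continuous (fun z : K => \val ((r z).1 i)).
  apply: (@continuous_comp_fun K _ R (fun z => (r z).1 i) (fun u => \val u)).
    exact: (continuous_comp_fun rc (@continuous_coord1 R i)).
  exact: val_unit_continuous.
have c2 i : continuous (fun z : K => \val ((r z).2 i)).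
  apply: (@continuous_comp_fun K _ R (fun z => (r z).2 i) (fun u => \val u)).
    exact: (continuous_comp_fun rc (@continuous_coord2 R i)).
  exact: val_unit_continuous.
split=> /=.
- apply: (@continuous_paste _ _ _ (fun f z => on_face f (r z))
    (fun f z => face_value W f (r z))) => //.
  + case=> [[i e]|[j e]] /=.
      apply: (@preimage_closed _ _ (fun z : K => \val ((r z).1 i))
        [set y | y = e%:R]); last exact: closed_eq.
      by move=> z _; exact: c1.
    (* The index of the missing face carries the empty set. *)
    case: (boolP ((_ != _) || _)) => je; last first.
      rewrite (_ : (fun _ => _) = set0); first exact: closed0.
      by apply/seteqP; split=> // z [].
    rewrite (_ : (fun _ => _) = fun z => onface (r z).2 j e); last first.
      by apply/funext => z; apply/propext; split=> [[]|].
    apply: (@preimage_closed _ _ (fun z : K => \val ((r z).2 j))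
      [set y | y = e%:R]); last exact: closed_eq.
    by move=> z _; exact: c2.
  + move=> f z fz; apply: (continuous_comp_fun rc).
    exact: (face_value_continuous gx IH fz).
- move=> p t t' tt'.
  have [e1 e2] := box_retract_ext k p (cleft_lt x) tt'.
  have [f fz] := cov (p, t); rewrite (WF f _ fz).
  move: e1 e2 fz; rewrite -!/(r _).
  have := WF f (p, t');
    case: (r (p, t)) (r (p, t')) => q u [q' u'] /= Wt qq uu' fz.
  subst q'.
  have fz' : on_face f (q, u').
    by case: f fz {Wt} => [[i e]|[j e]] //=; rewrite /onface uu'.
  by rewrite Wt//; apply: (face_value_finitary gx IH fz).
- by move=> i e z zi; rewrite (WF' (inl (i, e))).
- move=> y z yx zy; have yN : (rsize (cleft y) < rsize (ccat x))%N.
    by rewrite -yx cleft_lt.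
  rewrite (WF' (inr (Ordinal yN, true)))/= ?orbT//.
  by rewrite -{1}yx dec_ccat.
- move=> j z jN jx zj; rewrite (WF' (inr (Ordinal jN, false)))//=.
  by rewrite orbF.
Qed.

(** The value on [c] is the filler of the marked cell restricted to the missing face; each law for
    [c] comes from a law of that cell, corrected by the law at 0 for the inserted vertex. *)
Lemma plain_ok (A B : Y) (ns : ~~ small A B) (c : route A B) :
  cell_ok W (Marked (cutof ns c)) ->
  (forall (A' B' : Y) (c' : route A' B'), (weight c' < weight c)%N ->
    cell_ok W (Plain c')) ->
  cell_ok W (Plain c).
Proof.
set x := cutof ns c => okx IH; pose s := rsize (cleft x).
have pos (z : K) l : l = s -> onface (zins s z).2 l false.
  by move=> ->; exact: zins_pos.
have gx : good x by exact: cutof_good.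
have cx : cmerge x = c by exact: cutof_merge.
have FE z : value_of W c z = cell_value W (Marked x) (zins s z).
  by rewrite (value_of_large W ns).
have sx : (s < rsize (ccat x))%N by exact: cleft_lt.
have mx : mergeat (ccat x) s = c by rewrite /ccat mergeat_cat.
have cN : (rsize c).+1 = rsize (ccat x) by rewrite -mx rsize_mergeat.
split=> /=.
- have -> : value_of W c = fun z => cell_value W (Marked x) (zins s z).
    exact/funext.
  apply: (continuous_comp_fun (@zins_continuous R s)).
  exact: (ok_continuous okx).
- move=> p t t' tt'; rewrite !FE; apply: (ok_finitary okx) => i /=.
  rewrite -cN ltnS => ic; case: ltnP => [lt_is|le_si].
    by apply: tt'; move: sx; rewrite -cN; lia.
  by case: eqP => // /eqP nis; apply: tt'; lia.
- move=> i e z zi; rewrite FE (ok_param okx (z := zins s z) zi) /=.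
  rewrite (regular_mergeat (h_regular i e) sx) ?mx ?zdrop_ins//.
  exact: pos.
(* A cut of [c] comes from a cut [y'] of the marked sequence. The piece of [y'] containing the
   inserted vertex reduces to the piece of [c] by the law at 0, since the coordinate of that vertex
   is 0. *)
- move=> y z; rewrite FE -cx; case/ccat_eq_cmerge => [[u [ux ->]]|[u [ux ->]]].
    set y' := Cut (cleft u) (rcat (cright u) (cright x)) => zu;
      rewrite /= in zu.
    have y'x : ccat y' = ccat x by rewrite /ccat /= -rcatA -ux.
    have us : (rsize (cleft u) < s)%N by rewrite /s -ux /ccat rsize_cat; lia.
    have su : s = (rsize (cleft u) + rsize (cright u)).+1.
      by rewrite /s -ux /ccat rsize_cat.
    have [wl wr] := weight_pieces gx y'x; rewrite cx in wl wr.
    rewrite (ok_law1 okx (y := y'))//; last by rewrite /onface zins_lt.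
    rewrite /compose_at /=; congr ccomp.
      rewrite (ok_law0_plain (y := Cut (cright u) (cright x)) (IH _ _ _ wr)) /=.
        congr (value_of W _ _).
        rewrite -[in RHS](zdrop_ins s z) zafter_drop_gt//; congr (zdrop _ _).
        by rewrite su subSS addKn.
      exact: (pos z _ (esym su)).
    apply: (ok_finitary_plain (IH _ _ _ wl)) => // i iu.
    by rewrite zins_lt// (ltn_trans iu).
  set y' := Cut (rcat (cleft x) (cleft u)) (cright u) => zu.
  rewrite /= rsize_merge in zu.
  have y'x : ccat y' = ccat x by rewrite /ccat /= rcatA -ux.
  have [wl wr] := weight_pieces gx y'x; rewrite cx in wl wr.
  have su : bump s (s + rsize (cleft u)) = rsize (rcat (cleft x) (cleft u)).
    by rewrite rsize_cat /bump leq_addr.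
  rewrite (ok_law1 okx (y := y'))//; last first.
    by rewrite -[rsize _]su /onface zins_bump.
  rewrite /compose_at /=; congr ccomp.
    congr (value_of W _ _); rewrite -[in RHS](zdrop_ins s z).
    by rewrite rsize_cat rsize_merge zafter_drop_le// leq_addr.
  rewrite (ok_law0_plain (y := Cut (cleft x) (cleft u)) (IH _ _ _ wl)) /=.
    by rewrite zdrop_ins.
  exact: (pos z _ erefl).
- move=> j z jc _ zj; rewrite FE; pose j' := bump s j.
  have j'N : (j' < rsize (ccat x))%N by rewrite -cN /j' /bump; lia.
  have j's : j' != s by rewrite /j' /bump; lia.
  rewrite (ok_law0 okx (j := j'))//; last by rewrite /onface zins_bump.
  have [wj _] := weight_face gx j'N j's; rewrite cx in wj.
  (* If the mark is lost, the inserted vertex is still in the sequence, at position [s.-1] or [s],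
     and the law at 0 of this plain cell deletes it. *)
  have plain : cell_face (Marked x) j' = Plain (mergeat (ccat x) j') ->
      cell_value W (cell_face (Marked x) j') (zdrop j' (zins s z)) =
      value_of W (mergeat c j) (zdrop j z).
    move=> fj; rewrite fj in wj *; have okj := IH _ _ _ wj.
    have := rsize_mergeat j'N => sj'.
    have [js|sj] := ltnP j s.
      have jj' : j' = j by rewrite /j' /bump leqNgt js.
      rewrite jj' in okj sj' *; rewrite (ok_law0 okj (j := s.-1))//=.
      + rewrite zdrop_drop// zdrop_ins -mergeat_comm ?mx//.
        by rewrite js sx.
      + by lia.
      + have bj : bump j s.-1 = s by rewrite /bump; lia.
        exact: (pos z _ bj).
    have jj' : j' = j.+1 by rewrite /j' /bump sj.
    rewrite jj' in okj sj' j'N *; rewrite (ok_law0 okj (j := s))//=.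
    + rewrite -zdrop_drop// zdrop_ins mergeat_comm ?mx//.
      by rewrite j'N andbT.
    + by lia.
    + have bj : bump j.+1 s = s by rewrite /bump; lia.
      exact: (pos z _ bj).
  case: (ltnP j' s) => j's'; last by apply: plain; rewrite /= dec_None.
  have [u [du eu uj _]] := dec_cleft j's'.
  have [lu|lu] := eqVneq (lev (cmid u)) (lev A).+1; last first.
    by apply: plain; rewrite /= du (negbTE lu).
  have jj' : j' = j by move: j's'; rewrite /j' /bump; lia.
  rewrite /= du lu eqxx /= jj' in uj *.
  (* If the mark survives, the face is the very cell that [cutof] chooses for [mergeat c j], and its
     filler defines the value there. *)
  have -> : mergeat c j = rmerge (cmerge u) (cright x).
    by rewrite -cx /cmerge eu /ccat rmerge_catl -uj mergeat_cat rmergeA.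
  rewrite (value_of_large W ns) /= cutof_left//=.
  have su : rsize (cmerge u) = s.-1.
    by rewrite /s eu /cmerge /ccat rsize_merge rsize_cat.
  by rewrite su zdrop_zins// -jj'.
Qed.

Lemma all_ok (A B : Y) (G : cell A B) : good_cell G -> cell_ok W G.
Proof.
have [m] := ubnP (cell_weight G); elim: m A B G => // m IHm.
(* A large plain cell has the same weight as the marked cell defining its value, so the marked cells
   of a given weight are settled first. *)
have marked A B (x : cut A B) : (weight (cmerge x) < m.+1)%N -> good x ->
    cell_ok W (Marked x).
  move=> xm gx; apply: marked_ok => // A' B' G gG Gx; apply: IHm gG.
  exact: leq_trans Gx xm.
move=> A B [c|x] /= cm gG; last exact: marked.
have [s|ns] := boolP (small A B); first exact: small_ok.
apply: (@plain_ok _ _ ns); last first.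
  by move=> A' B' c' c'c; apply: IHm => //=; exact: leq_trans c'c cm.
by apply: marked; rewrite ?cutof_merge.
Qed.

Lemma value_of_regular : regular (value_of W).
Proof.
split=> [A B c|A B c|A B y z|A B y z].
- exact: (ok_continuous (@all_ok _ _ (Plain c) I)).
- exact: (ok_finitary (@all_ok _ _ (Plain c) I)).
- exact: (ok_law1_plain (@all_ok _ _ (Plain (ccat y)) I)).
- exact: (ok_law0_plain (@all_ok _ _ (Plain (ccat y)) I)).
Qed.

End Solution.

Lemma value_of_ext (W W' : fillers) (A B : Y) (c : route A B) :
  (forall ns : ~~ small A B, W _ _ (cutof ns c) = W' _ _ (cutof ns c)) ->
  value_of W c = value_of W' c.
Proof.
move=> WW'; have [s|ns] := boolP (small A B);
  first by rewrite !(value_of_small _ s).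
by rewrite !(value_of_large _ ns) WW'.
Qed.

(** The fixed point equation reads [W] at smaller weights only, so the masking in [measure_fix] does
    not affect it. *)
Lemma face_value_local (W W' : fillers) (A B : Y) (x : cut A B) : good x ->
  (forall A' B' (y : cut A' B'), (weight (cmerge y) < weight (cmerge x))%N ->
    W A' B' y = W' A' B' y) ->
  forall (f : face_index x) z, on_face f z ->
    face_value W f z = face_value W' f z.
Proof.
move=> gx WW'.
have FF' A' B' (c : route A' B') : (weight c < weight (cmerge x))%N ->
    value_of W c = value_of W' c.
  by move=> cx; apply: value_of_ext => ns; rewrite WW'// cutof_merge.
case=> [[i e]|[j []]] z // [jx _].
  have [y [dy /esym ey _]] := dec_split (ltn_ord j).
  have [wl wr] := weight_pieces gx ey.
  by rewrite /= dy /compose_at !FF'.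
rewrite orbF in jx; have [wj _] := weight_face gx (ltn_ord j) jx.
rewrite /face_value.
by case: (cell_face _ _) wj => /= [c|y] w; [rewrite FF'|rewrite WW'].
Qed.

Lemma fillers_exist : exists W : fillers,
  forall A B (x : cut A B), good x -> forall z,
  W A B x z =
    filler_of W x (box_retract k (rsize (ccat x)) (rsize (cleft x)) z).
Proof.
pose I := {A : Y & {B : Y & cut A B}}.
pose V (i : I) := K -> chom (O (projT1 i)) (O (projT1 (projT2 i))).
pose ix A B (x : cut A B) : I := existT _ A (existT _ B x).
pose mu (i : I) := weight (cmerge (projT2 (projT2 i))).
pose toW (V0 : forall i, V i) : fillers := fun A B x => V0 (ix A B x).
pose S (V0 : forall i, V i) (i : I) : V i := fun z =>
  let x := projT2 (projT2 i) in
  filler_of (toW V0) x (box_retract k (rsize (ccat x)) (rsize (cleft x)) z).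
have [V0 V0E] := measure_fix mu
  (fun i : I => (fun=> dflt (cmerge (projT2 (projT2 i)))) : V i) S.
exists (toW V0) => A B x gx z; rewrite {1}/toW V0E /S /=.
set z' := box_retract _ _ _ z; rewrite /filler_of.
case: pickP => // f /asboolP fz.
apply: (face_value_local gx) fz => A' B' y yx.
by rewrite /toW /mu /= yx.
Qed.

Theorem extension_exists : exists F : values,
  [/\ regular F,
      forall A B (s : small A B) (c : route A B), F A B c = g s c &
      forall (i : 'I_k) e A B (c : route A B) z, onface z.1 i e ->
        F A B c z = h i e c z].
Proof.
have [W WE] := fillers_exist; exists (value_of W); split.
- exact: value_of_regular.
- by move=> A B s c; rewrite (value_of_small W s).
- move=> i e A B c z zi.
  by rewrite -(ok_param (all_ok WE (G := Plain c) Logic.I) zi).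
Qed.

End Core.

(** * Insertion of a vertex on a given level *)

Section LevelCut.
Variables (X : category) (n : nat).
Local Notation Y := (prod_cat X (ordcat n)).

Definition lev (A : Y) : nat := A.2.

Lemma lev_mono (A B : Y) : hom B A -> (lev A <= lev B)%N.
Proof. by case. Qed.

(** A morphism from [B] to [A] is [drop_hom] followed by [lift_hom], passing through the object
    under [B] on level [q]. *)
Definition lift_hom (A B : Y) (q : 'I_n.+1) (f : hom B A) (Aq : (A.2 <= q)%N) :
  @hom Y (B.1, q) A := (f.1, Aq).

Definition drop_hom (B : Y) (q : 'I_n.+1) (qB : (q <= B.2)%N) :
  @hom Y B (B.1, q) := (cat_id B.1, qB).

(* The sequence is cut just before its first vertex of level above [q]: that
   vertex, moved down to level [q], is inserted. *)
Fixpoint cut_level (q : 'I_n.+1) (A B : Y) (c : route A B) :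
    (lev A <= q)%N -> (q < lev B)%N -> cut A B :=
  match c in route A B return (lev A <= q)%N -> (q < lev B)%N -> cut A B with
  | route1 A B f => fun Aq qB =>
    Cut (route1 (lift_hom f Aq)) (route1 (drop_hom (ltnW qB)))
  | routeS A X B f c' => fun Aq qB =>
    match leqP (lev X) q with
    | LeqNotGtn Xq => let x := cut_level c' Xq qB in
      Cut (routeS f (cleft x)) (cright x)
    | GtnNotLeq qX =>
      Cut (route1 (lift_hom f Aq)) (routeS (drop_hom (ltnW qX)) c')
    end
  end.

Arguments cut_level q {A B} c _ _.

(** By [cut_level_lifted] and [cut_level_unique], these are the right halves that [cut_level]
    produces. *)
Inductive lifted (q : 'I_n.+1) : forall M B : Y, route M B -> Prop :=
  | lifted1 (B : Y) (qB : (q <= B.2)%N) (lt_qB : (q < lev B)%N) :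
    lifted q (route1 (drop_hom qB))
  | liftedS (X B : Y) (qX : (q <= X.2)%N) (lt_qX : (q < lev X)%N)
      (c : route X B) : lifted q (routeS (drop_hom qX) c).

Lemma cut_level_lifted (q : 'I_n.+1) (A B : Y) (c : route A B) Aq qB :
  let x := cut_level q c Aq qB in lev (cmid x) = q /\ lifted q (cright x).
Proof.
elim: c Aq qB => [A' B' f|A' Z B' f c IH] Aq qB /=; first by split=> //;
  constructor.
case: leqP => [Zq|qZ]; first exact: IH.
by split=> //; constructor.
Qed.

Lemma cut_level_merge (q : 'I_n.+1) (A B : Y) (c : route A B) Aq qB :
  cmerge (cut_level q c Aq qB) = c.
Proof.
have eqf (A' B' : Y) (f : hom B' A') (Aq' : (A'.2 <= q)%N) (qB' :
  (q <= B'.2)%N) :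
    cat_comp (lift_hom f Aq') (drop_hom qB') = f.
  case: f => f1 f2; rewrite /lift_hom /drop_hom /=.
  by congr pair; [exact: cat_compm1|exact: bool_irrelevance].
elim: c Aq qB => [A' B' f|A' Z B' f c IH] Aq qB.
  by congr route1; exact: eqf.
rewrite /cmerge /=; case: leqP => [Zq|qZ] /=.
  by congr routeS; exact: IH.
by congr routeS; exact: eqf.
Qed.

(** Since [a] ends on level [q], none of its vertices is above [q]; the search therefore passes over
    [a] and stops at the end of the first morphism of [b]. *)
Lemma cut_level_unique (q : 'I_n.+1) (A M B : Y) (a : route A M)
    (b : route M B) Aq qB : lifted q b ->
  cut_level q (rmerge a b) Aq qB = Cut a b.
Proof.
move=> lb; elim: a b lb Aq qB => [A' M' f b lb|A' Z M' f a IH b lb] Aq qB.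
  case: lb f qB Aq => [B' qB' lt f|Z B' qZ lt c f] qB Aq /=.
    rewrite (bool_irrelevance (ltnW qB) qB') (_ : lift_hom _ _ = f)//.
    by case: f => f1 f2; congr pair;
      [exact: cat_compm1|exact: bool_irrelevance].
  case: leqP => [Zq|qZ'] /=; first by exfalso; move: lt; rewrite ltnNge Zq.
  rewrite (bool_irrelevance (ltnW qZ') qZ) (_ : lift_hom _ _ = f)//.
  by case: f => f1 f2; congr pair; [exact: cat_compm1|exact: bool_irrelevance].
rewrite /=; case: leqP => [Zq|qZ] /=; first by rewrite IH.
have := route_le (@lev_mono) a; have : lev M' = q by case: lb.
by lia.
Qed.

Lemma cut_level_count (q : 'I_n.+1) (M B : Y) (b : route M B) : lifted q b ->
  rcount (fun X => lev X == q) b = 0%N.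
Proof.
have above (A' B' : Y) (c : route A' B') : (q < lev A')%N ->
    rcount (fun X => lev X == q) c = 0%N.
  elim: c => //= A1 Z B1 f c IH qA; have := lev_mono f => AZ.
  rewrite IH; last exact: leq_trans AZ.
  by rewrite gtn_eqF//; exact: leq_trans AZ.
case=> // Z B' qZ lt c /=; rewrite above// gtn_eqF//.
Qed.

Lemma large_next (A B : Y) : ~~ small (@lev) A B -> ((lev A).+1 < n.+1)%N.
Proof.
rewrite /small -ltnNge => AB; apply: leq_trans AB _.
by rewrite ltnW// (ltn_ord B.2).
Qed.

Definition next_level (A B : Y) (ns : ~~ small (@lev) A B) : 'I_n.+1 :=
  Ordinal (large_next ns).

Lemma next_level_gt (A B : Y) (ns : ~~ small (@lev) A B) :
  (next_level ns < lev B)%N.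
Proof. by rewrite /= ltnNge; exact: ns. Qed.

Definition cutof (A B : Y) (ns : ~~ small (@lev) A B) (c : route A B) :
    cut A B :=
  cut_level (next_level ns) c (leqnSn _) (next_level_gt ns).

Lemma cutof_good (A B : Y) (ns : ~~ small (@lev) A B) c :
  good (@lev) (cutof ns c).
Proof.
have /= [lM lb] :=
  @cut_level_lifted (next_level ns) A B c (leqnSn _) (next_level_gt ns).
split; first exact: lM.
  by rewrite lM; exact: next_level_gt.
exact: cut_level_count lb.
Qed.

Lemma cutof_merge (A B : Y) (ns : ~~ small (@lev) A B) c :
  cmerge (cutof ns c) = c.
Proof. exact: cut_level_merge. Qed.

Lemma cutof_left (A B : Y) (ns : ~~ small (@lev) A B) c
    (y : cut A (cmid (cutof ns c))) :
  cutof ns (rmerge (cmerge y) (cright (cutof ns c))) =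
  Cut (cmerge y) (cright (cutof ns c)).
Proof.
apply: cut_level_unique.
by have [] :=
  @cut_level_lifted (next_level ns) A B c (leqnSn _) (next_level_gt ns).
Qed.

End LevelCut.

(** * Evaluation of flexible functors *)

Section CubeTopology.
Variable R : realType.

Lemma unit_interval_compact : compact [set: unit_interval R].
Proof.
have -> : [set: unit_interval R] = @clamp R @` `[0, 1]%classic.
  apply/seteqP; split=> // x _; exists (\val x); last exact: clamp_val.
  by rewrite /= in_itv /= val_unit.
apply: continuous_compact; last exact: segment_compact.
exact/continuous_subspaceT/clamp_continuous.
Qed.

Lemma unit_interval_hausdorff : hausdorff_space (unit_interval R).
Proof.
rewrite open_hausdorff => x y xy.
have vxy : \val x != \val y by rewrite (inj_eq val_inj).
have := @Rhausdorff R; rewrite open_hausdorff => /(_ _ _ vxy).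
move=> [[A B] /= [xA yB] [Aop Bop AB]].
exists (\val @^-1` A, \val @^-1` B) => /=.
  by split; apply/mem_set; [exact: set_mem xA|exact: set_mem yB].
split.
- by apply: open_comp => // z _; exact: val_unit_continuous.
- by apply: open_comp => // z _; exact: val_unit_continuous.
- by rewrite -preimage_setI (eqP AB) preimage_set0.
Qed.

Lemma cube_compact m : compact [set: cube R m].
Proof.
have := @tychonoff 'I_m (fun=> unit_interval R) (fun=> setT)
  (fun=> unit_interval_compact).
by congr compact; apply/seteqP; split.
Qed.

Lemma cube_hausdorff m : hausdorff_space (cube R m).
Proof.
exact: (@hausdorff_product 'I_m (fun=> unit_interval R)
  (fun=> unit_interval_hausdorff)).
Qed.

Lemma cube_locally_compact m : locally_compact [set: cube R m].
Proof.
move=> x _; exists setT; first exact: filterT.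
by split; [exact: cube_compact|exact: closedT].
Qed.

Definition restr m (t : Ivec R) : cube R m := fun i => t i.
Arguments restr m t : clear implicits.

Lemma restr_continuous m : continuous (restr m).
Proof. by apply: continuous_into_prod => i; exact: continuous_eval. Qed.

Definition extend m (t : cube R m) : Ivec R :=
  fun i => if insub i is Some j then t j else clamp 0.

Lemma extendE m (t : cube R m) (i : 'I_m) : extend t i = t i.
Proof. by rewrite /extend valK. Qed.

Lemma extend_lt m (t : cube R m) i (im : (i < m)%N) :
  extend t i = t (Ordinal im).
Proof. by rewrite -(extendE t (Ordinal im)). Qed.

Lemma restr_extend m (t : cube R m) : restr m (extend t) = t.
Proof. by apply/funext => i; rewrite /restr extendE. Qed.

Lemma extend_continuous m : continuous (@extend m).
Proof.
apply: continuous_into_prod => i; rewrite /extend.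
case: insubP => [j _ _|_]; last exact: cst_continuous.
exact: continuous_eval.
Qed.

(** One half of the exponential law; it rests on the cube being locally compact and Hausdorff. *)
Lemma map_space_uncurry (S : topologicalType) m (Z : topologicalType)
    (phi : S -> map_space (cube R m) Z) :
  continuous phi -> continuous (fun z : S * cube R m => phi z.1 z.2).
Proof.
move=> cphi.
pose f (s : S) : {compact-open, cube R m -> Z} := (phi s : cube R m -> Z).
have cf : continuous f.
  apply: (@continuous_comp_fun _ _ _ phi
    (id : map_space (cube R m) Z -> {compact-open, cube R m -> Z})) => //.
  exact: initial_continuous.
rewrite (_ : (fun _ => _) = uncurry f); last by apply/funext; case.
apply: (continuous_uncurry (@cube_locally_compact m) (@cube_hausdorff m) cf).
by move=> s; exact: cts_fun.
Qed.

Lemma map_space_curry (S : topologicalType) m (Z : topologicalType)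
    (phi : S -> map_space (cube R m) Z) :
  continuous (fun z : S * cube R m => phi z.1 z.2) -> continuous phi.
Proof.
move=> cphi; apply: continuous_comp_initial.
exact: (continuous_curry_fun cphi).
Qed.

End CubeTopology.

Arguments restr {R} m t.

Section Evaluation.
Variables (R : realType) (C : continuous_category) (Y : category) (O : Y -> C).

Definition ev (F : prefunctor_space R O) (A B : Y) (c : route A B)
    (t : Ivec R) : chom (O A) (O B) := value F (to_chain c) (restr _ t).

(** Transports evaluation along an equality of packed chains, so that no cast between lengths
    appears. *)
Lemma ev_sroute F (A B : Y) (c : route A B) m (c' : chain m A B) t :
  sroute c = existT (fun m => chain m A B) m c' ->
  ev F c t = value F c' (restr m t).
Proof.
move=> e; pose f (s : {m & chain m A B}) := value F (projT2 s) (restr _ t).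
by rewrite -[RHS]/(f (existT _ m c')) -e.
Qed.

Lemma ev_of_chain F m (A B : Y) (c : chain m A B) t :
  ev F (of_chain c) t = value F c (restr m t).
Proof. exact/ev_sroute/sroute_of_chain. Qed.

Lemma ev_inj F F' :
  (forall A B (c : route A B) t, ev F c t = ev F' c t) -> F = F'.
Proof.
move=> FF'; apply: functional_extensionality_dep => -[m A B c].
apply/continuousEP => t; have := FF' _ _ (of_chain c) (extend t).
by rewrite !ev_of_chain restr_extend.
Qed.

Lemma ev_finitary F (A B : Y) (c : route A B) t t' :
  (forall i, (i < rsize c)%N -> t i = t' i) -> ev F c t = ev F c t'.
Proof. by move=> tt'; congr value; apply/funext => i; exact: tt'. Qed.

Lemma ev_law0 F (A B : Y) (y : cut A B) t : is_flexible F ->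
  onface t (rsize (cleft y)) false ->
  ev F (ccat y) t = ev F (cmerge y) (fun i => t (bump (rsize (cleft y)) i)).
Proof.
case=> F0 _ _ t0; rewrite (ev_sroute _ _ (sroute_cat _ _)) F0//.
by rewrite (ev_sroute _ _ (sroute_merge _ _)).
Qed.

Lemma ev_law1 F (A B : Y) (y : cut A B) t : is_flexible F ->
  onface t (rsize (cleft y)) true ->
  ev F (ccat y) t =
  ccomp (ev F (cright y) (fun i => t (rsize (cleft y) + i).+1))
        (ev F (cleft y) t).
Proof.
case=> _ F1 _ t1; rewrite (ev_sroute _ _ (sroute_cat _ _)) F1//.
congr ccomp; congr value; apply/funext => j.
  by rewrite /cube_after /restr /= /bump leq_addr.
by rewrite /cube_before /restr /= /bump leqNgt ltn_ord.
Qed.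

Lemma ev_id F (A : Y) t : is_flexible F ->
  ev F (route1 (cat_id A)) t = cid (O A).
Proof. by case=> _ _ Fid; exact: Fid. Qed.

Lemma ev_continuous (phi : Ivec R -> prefunctor_space R O) (A B : Y)
    (c : route A B) : continuous phi ->
  continuous (fun z : Ivec R * Ivec R => ev (phi z.1) c z.2).
Proof.
move=> cphi.
pose s := ComposableSequence (to_chain c).
have cs : continuous (fun p => phi p s).
  apply: (@continuous_comp_fun _ _ _ phi
    (fun F : prefunctor_space R O => F s)) => //.
  exact: (@continuous_eval (composable_sequence Y) (fun s =>
    map_space (cube R (cs_dim s)) (chom (O (cs_src s)) (O (cs_tgt s)))) s).
have := map_space_uncurry cs; apply: (@continuous_comp_fun _ _ _
  (fun z : Ivec R * Ivec R => (z.1, restr (rsize c) z.2))).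
have [c1 c2] := continuous_fst_snd (Ivec R) (Ivec R).
apply: continuous_pair => //.
exact: (continuous_comp_fun c2 (@restr_continuous R _)).
Qed.

Lemma ev_continuous2 F (A B : Y) (c : route A B) :
  continuous (fun z : Ivec R * Ivec R => ev F c z.2).
Proof. exact: (@ev_continuous (cst F)) (@cst_continuous _ _ F). Qed.

End Evaluation.

Section EvaluationPullback.
Variables (R : realType) (C : continuous_category) (Y Z : category).
Variables (P : functor Y Z) (O : Z -> C).

Lemma sroute_rmap (A B : Y) (c : route A B) :
  sroute (rmap P c) = existT (fun m => chain m (P A) (P B)) _
    (chain_map P (to_chain c)).
Proof.
elim: c => //= A' X B' f c IH.
by transitivity (schainS (fmap P f) (sroute (rmap P c))); last rewrite IH.
Qed.

Lemma ev_pullback (F : prefunctor_space R O) (A B : Y) (c : route A B) t :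
  ev (pullback P F) c t = ev F (rmap P c) t.
Proof. by rewrite (ev_sroute _ _ (sroute_rmap _)). Qed.

End EvaluationPullback.

(** * The values prescribed by the edges *)

Section Packing.

(** Routes are packed with their ends in order to compare routes whose ends are equal only
    propositionally. *)
Definition packed (Y : category) := {A : Y & {B : Y & route A B}}.

Definition pack (Y : category) (A B : Y) (c : route A B) : packed Y :=
  existT _ A (existT _ B c).

Definition packmap (Y Z : category) (P : functor Y Z) (s : packed Y) :
  packed Z := pack (rmap P (projT2 (projT2 s))).

(** Uniqueness of identity proofs is used, as equality of objects need not be decidable. *)
Lemma pack_inj (Y : category) (A B : Y) : injective (@pack Y A B).
Proof. by move=> c c' e; have := Eqdep.EqdepTheory.inj_pair2 _ _ _ _ _
  (Eqdep.EqdepTheory.inj_pair2 _ _ _ _ _ e). Qed.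

End Packing.

Section Levels.
Variable X : category.

Program Definition mono_functor a b (e : 'I_a.+1 -> 'I_b.+1)
    (he : forall i j : 'I_a.+1, (i <= j)%N -> (e i <= e j)%N) :
    functor (prod_cat X (ordcat a)) (prod_cat X (ordcat b)) := {|
  fobj A := (A.1, e A.2);
  fmap A B f := (f.1, he _ _ f.2)
|}.
Next Obligation. by move=> *; congr pair; apply: bool_irrelevance. Qed.
Next Obligation. by move=> *; congr pair; apply: bool_irrelevance. Qed.

Lemma pack_mono_id a (e : 'I_a.+1 -> 'I_a.+1)
    (he : forall i j : 'I_a.+1, (i <= j)%N -> (e i <= e j)%N)
    (A B : prod_cat X (ordcat a)) (c : route A B) :
  (forall l : 'I_a.+1, (lev A <= l <= lev B)%N -> e l = l) ->
  pack (rmap (@mono_functor a a e he) c) = pack c.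
Proof.
elim: c => [[x l] [y l'] [f1 f2]|[x l] [z m] [y l'] [f1 f2] c IH] el.
  have ll : (l <= l')%N := f2.
  have el1 : e l = l by apply: el; rewrite /lev /= leqnn.
  have el' : e l' = l' by apply: el; rewrite /lev /= leqnn andbT.
  (* The order proof is generalised so that its type can be rewritten, and is then identified by
     irrelevance. *)
  rewrite /pack /=; move: (he _ _ _); rewrite /= el1 el' => f2'.
  by rewrite (bool_irrelevance f2' f2).
have lm : (l <= m)%N := f2.
have mB : (m <= l')%N := route_le (@lev_mono X a) c.
have {}IH := IH (fun i im => el i (introT andP
  (conj (leq_trans lm (proj1 (andP im))) (proj2 (andP im))))).
have el1 : e l = l by apply: el; rewrite /lev /= leqnn (leq_trans lm).
have el' : e l' = l' by apply: el; rewrite /lev /= leqnn (leq_trans lm).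
have em : e m = m by apply: el; rewrite /lev /= lm.
move: IH; rewrite /pack /=; move: (rmap _ c) (he _ _ _).
rewrite /= el1 el' em => c' f2' /pack_inj ->.
by rewrite (bool_irrelevance f2' f2).
Qed.

Program Definition base_functor n : functor (prod_cat X (ordcat n)) X := {|
  fobj A := A.1;
  fmap A B f := f.1
|}.
Next Obligation. by []. Qed.
Next Obligation. by []. Qed.

Lemma rmap_base_level n (l : 'I_n.+1) (A B : X) (c : route A B) :
  rmap (base_functor n) (rmap (level X l) c) = c.
Proof. by elim: c => //= A' Z B' f c ->. Qed.

Lemma packmap_base_level n (l : 'I_n.+1) (s : packed X) :
  packmap (base_functor n) (packmap (level X l) s) = s.
Proof. by case: s => A [B c]; rewrite /packmap /= rmap_base_level. Qed.

Lemma pack_level_base n (l : 'I_n.+1) (A B : prod_cat X (ordcat n))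
    (c : route A B) : A.2 = l -> B.2 = l ->
  pack (rmap (level X l) (rmap (base_functor n) c)) = pack c.
Proof.
move=> Al Bl; have hl (i j : 'I_n.+1) : (i <= j)%N -> (l <= l)%N by [].
rewrite -[RHS](@pack_mono_id _ (fun=> l) hl); last first.
  by move=> m; rewrite /lev Al Bl -eqn_leq => /eqP/val_inj.
congr pack; elim: c {Al Bl} => [A' B' f|A' Z B' f c IH] /=.
  by congr route1; congr pair; exact: bool_irrelevance.
by congr routeS => //; congr pair; exact: bool_irrelevance.
Qed.

(** The retraction of [ordcat n] onto its edge between [i] and [i + 1], left inverse to
    [ord_step i]. *)
Definition collapse n (i : 'I_n) (l : 'I_n.+1) : 'I_2 :=
  if (l <= i)%N then ord0 else ord_max.

Lemma collapse_hom n (i : 'I_n) (j k : 'I_n.+1) :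
  (j <= k)%N -> (collapse i j <= collapse i k)%N.
Proof.
rewrite /collapse => jk; case: ifP => //; case: ifP => // ki /negP[].
exact: leq_trans ki.
Qed.

Definition collapse_functor n (i : 'I_n) := mono_functor (@collapse_hom n i).

Lemma pack_edge_collapse n (i : 'I_n) (A B : prod_cat X (ordcat n))
    (c : route A B) : (i <= lev A)%N -> (lev B <= i.+1)%N ->
  pack (rmap (edge_functor X i) (rmap (collapse_functor i) c)) = pack c.
Proof.
move=> iA Bi.
have he (j k : 'I_n.+1) : (j <= k)%N ->
    (ord_step i (collapse i j) <= ord_step i (collapse i k))%N.
  by move=> jk; exact/ord_step_hom/collapse_hom.
rewrite -[RHS](pack_mono_id (e := fun l => ord_step i (collapse i l)) he).
  congr pack; elim: c {iA Bi} => [A' B' f|A' Z B' f c IH] /=.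
    by congr route1; congr pair; exact: bool_irrelevance.
  by congr routeS => //; congr pair; exact: bool_irrelevance.
move=> l /andP[Al lB]; apply: val_inj => /=; rewrite val_ord_step /collapse.
by case: leqP => /= li; lia.
Qed.

Lemma packmap_collapse_edge n (i : 'I_n) (s : packed (prod_cat X (ordcat 1))) :
  packmap (collapse_functor i) (packmap (edge_functor X i) s) = s.
Proof.
case: s => A [B c]; rewrite /packmap /= -/(pack c).
have he (j k : 'I_2) : (j <= k)%N ->
    (collapse i (ord_step i j) <= collapse i (ord_step i k))%N.
  by move=> jk; exact/collapse_hom/ord_step_hom.
rewrite -[RHS](pack_mono_id (e := fun l => collapse i (ord_step i l)) he).
  congr pack; elim: c => [A' B' f|A' Z B' f c IH] /=.
    by congr route1; congr pair; exact: bool_irrelevance.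
  by congr routeS => //; congr pair; exact: bool_irrelevance.
move=> l _; apply: val_inj; rewrite /collapse val_ord_step.
by case: l => [[|[|l]]] //= _; [rewrite addn0 leqnn|rewrite addn1 ltnn].
Qed.

Lemma rmap_edge_level n (i : 'I_n) (k : 'I_2) (A B : X) (c : route A B) :
  rmap (edge_functor X i) (rmap (level X k) c) =
  rmap (level X (ord_step i k)) c.
Proof.
elim: c => [A' B' f|A' Z B' f c IH] /=.
  by congr route1; congr pair; exact: bool_irrelevance.
by congr routeS => //; congr pair; exact: bool_irrelevance.
Qed.

End Levels.

Section Base.
Variables (R : realType) (X : category) (C : continuous_category) (n : nat).
Variable T : 'I_n.+1 -> flexible_functor R C X.
Variable G : forall i : 'I_n, Hom_space (fun k : 'I_2 => T (ord_step i k)).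
Local Notation Y := (prod_cat X (ordcat n)).
Local Notation O := (Hom_objects T).
Local Notation K := (Ivec R * Ivec R)%type.

(* The functors into [Y] along which the values of the functor to be
   constructed are prescribed. *)
Record source := Source {
  src_cat : category;
  src_fun : functor src_cat Y;
  src_map : prefunctor_space R (fun A => O (src_fun A))
}.

Arguments src_map s : clear implicits.

Definition edge_source (i : 'I_n) : source :=
  @Source (prod_cat X (ordcat 1)) (edge_functor X i) (\val (\val (G i))).

Definition level_source (l : 'I_n.+1) : source :=
  @Source X (level X l) (\val (ff_map (T l))).

Variant prescribed : source -> Prop :=
  | PrescribedEdge i : prescribed (edge_source i)
  | PrescribedLevel l : prescribed (level_source l).

Lemma prescribed_flexible (S : source) : prescribed S ->
  is_flexible (src_map S).
Proof. by case=> [i|l] /=; case: (X in \val X) => F /= /set_mem. Qed.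

Definition packed_value := {A : Y & {B : Y & Ivec R -> chom (O A) (O B)}}.

Definition pack_value (A B : Y) (v : Ivec R -> chom (O A) (O B)) :
  packed_value := existT _ A (existT _ B v).

Definition src_value (S : source) (s : packed (src_cat S)) : packed_value :=
  pack_value (A := src_fun S (projT1 s)) (B := src_fun S (projT1 (projT2 s)))
    (ev (src_map S) (projT2 (projT2 s))).

Lemma pack_value_inj (A B : Y) : injective (@pack_value A B).
Proof. by move=> v v' e; have := Eqdep.EqdepTheory.inj_pair2 _ _ _ _ _
  (Eqdep.EqdepTheory.inj_pair2 _ _ _ _ _ e). Qed.

Lemma level_value_unique l l' (s s' : packed X) :
  packmap (level X l) s = packmap (level X l') s' ->
  @src_value (level_source l) s = @src_value (level_source l') s'.
Proof.
move=> e; have ll' : l = l' by exact: (congr1 (fun r => (projT1 r).2) e).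
have /(congr1 (packmap (base_functor X n))) := e.
by rewrite !packmap_base_level ll' => ->.
Qed.

(** A sequence of the edge with both ends on level [k] stays there, where [G i] restricts to
    [T (ord_step i k)]. *)
Lemma edge_value_level (i : 'I_n) (k : 'I_2)
    (s : packed (prod_cat X (ordcat 1))) :
  (projT1 s).2 = k -> (projT1 (projT2 s)).2 = k ->
  exists s1 : packed X,
    packmap (edge_functor X i) s = packmap (level X (ord_step i k)) s1 /\
    @src_value (edge_source i) s = @src_value (level_source (ord_step i k)) s1.
Proof.
case: s => A [B c] /= Ak Bk; have := pack_level_base c Ak Bk.
rewrite /pack => <-; exists (pack (rmap (base_functor X 1) c)).
split; first by rewrite /packmap /= rmap_edge_level.
rewrite /src_value /=; congr pack_value; apply/funext => t.
transitivity (ev (pullback (level X k) (\val (\val (G i))))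
  (rmap (base_functor X 1) c) t); first exact: esym (ev_pullback _ _ _ _).
have /set_mem /(_ k) /(congr1 \val) e := valP (G i).
by rewrite -[pullback _ _]/(\val (ff_restrict (level X k) (\val (G i)))) e.
Qed.

(** Different edges have at most one level in common, so a sequence in both images stays on it. *)
Lemma edge_const (i j : 'I_n) (s s' : packed (prod_cat X (ordcat 1))) :
  packmap (edge_functor X i) s = packmap (edge_functor X j) s' -> i != j ->
  (projT1 s).2 = (projT1 (projT2 s)).2.
Proof.
move=> e ij; apply: val_inj => /=.
have eA : (i + (projT1 s).2 = j + (projT1 s').2)%N.
  by rewrite -!val_ord_step; exact: (congr1 (fun r => val (projT1 r).2) e).
have eB : (i + (projT1 (projT2 s)).2 = j + (projT1 (projT2 s')).2)%N.
  rewrite -!val_ord_step.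
  exact: (congr1 (fun r => val (projT1 (projT2 r)).2) e).
have k1 : ((projT1 s).2 <= (projT1 (projT2 s)).2)%N.
  exact: route_le (@lev_mono X 1) (projT2 (projT2 s)).
have k2 : ((projT1 s').2 <= (projT1 (projT2 s')).2)%N.
  exact: route_le (@lev_mono X 1) (projT2 (projT2 s')).
have l1 : ((projT1 (projT2 s)).2 < 2)%N by exact: ltn_ord.
have l2 : ((projT1 (projT2 s')).2 < 2)%N by exact: ltn_ord.
have nij : (i : nat) != j by [].
move: (nat_of_ord (projT1 s).2) (nat_of_ord (projT1 (projT2 s)).2) eA eB k1 k2 l1 l2.
move: (nat_of_ord (projT1 s').2) (nat_of_ord (projT1 (projT2 s')).2).
by lia.
Qed.

Lemma edge_level_const (i : 'I_n) l (s : packed (prod_cat X (ordcat 1))) s' :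
  packmap (edge_functor X i) s = packmap (level X l) s' ->
  (projT1 s).2 = (projT1 (projT2 s)).2.
Proof.
move=> e; apply: val_inj => /=; apply/eqP; rewrite -(eqn_add2l i); apply/eqP.
rewrite -!val_ord_step.
have -> := congr1 (fun r => val (projT1 r).2) e.
by have -> := congr1 (fun r => val (projT1 (projT2 r)).2) e.
Qed.

(** Two different sources can only overlap on a single level; there both values are those of [T]. *)
Lemma src_value_unique (S S' : source) (s : packed (src_cat S))
    (s' : packed (src_cat S')) : prescribed S -> prescribed S' ->
  packmap (src_fun S) s = packmap (src_fun S') s' -> src_value s = src_value s'.
Proof.
move=> pS pS'; case: pS s => [i|l] s; case: pS' s' => [j|l'] s' /= e.
- have [ij|ij] := eqVneq i j.
    move: s' e; rewrite -ij => s' /(congr1 (packmap (collapse_functor X i))).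
    by rewrite !packmap_collapse_edge => ->.
  have [s1 [e1 ->]] := edge_value_level i erefl (esym (edge_const e ij)).
  rewrite eq_sym in ij.
  have [s2 [e2 ->]] := edge_value_level j erefl (esym (edge_const (esym e) ij)).
  by apply: level_value_unique; rewrite -e1 -e2.
- have [s1 [e1 ->]] := edge_value_level i erefl (esym (edge_level_const e)).
  by apply: level_value_unique; rewrite -e1.
- have [s1 [e1 ->]] :=
    edge_value_level j erefl (esym (edge_level_const (esym e))).
  by apply: level_value_unique; rewrite -e1.
- exact: level_value_unique.
Qed.

Inductive image (S : source) : forall A B : Y, route A B -> Prop :=
  Image A0 B0 (c0 : @route (src_cat S) A0 B0) : image S (rmap (src_fun S) c0).

Lemma image_packmap (S : source) (s : packed (src_cat S)) (A B : Y)
    (c : route A B) : packmap (src_fun S) s = pack c -> image S c.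
Proof.
move=> e; pose f (r : packed Y) := image S (projT2 (projT2 r)).
by rewrite -[image S c]/(f (pack c)) -e; exact: Image.
Qed.

(** If [A] lies below level [n], the routes lie in the edge starting at the level of [A]. On the top
    level they stay on that level; this covers [n = 0], where there are no edges. *)
Lemma small_image (A B : Y) : small (@lev X n) A B -> exists S : source,
  prescribed S /\ forall c : route A B, image S c.
Proof.
rewrite /small => AB; case: (ltnP (lev A) n) => An.
  exists (edge_source (Ordinal An)); split=> [|c]; first by constructor.
  apply: (@image_packmap (edge_source (Ordinal An))
    (pack (rmap (collapse_functor X (Ordinal An)) c))).
  exact: pack_edge_collapse.
exists (level_source A.2); split=> [|c]; first by constructor.
apply: (@image_packmap (level_source A.2) (pack (rmap (base_functor X n) c))).
apply: pack_level_base => //.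
have Bn : (B.2 <= n)%N by rewrite -ltnS; exact: ltn_ord.
have AB' : (A.2 <= B.2)%N := route_le (@lev_mono X n) c.
by apply: val_inj; apply/eqP; rewrite eqn_leq (leq_trans Bn An).
Qed.

Definition base_value (A B : Y) (c : route A B)
    (v : Ivec R -> chom (O A) (O B)) : Prop :=
  exists S : source, prescribed S /\ exists s : packed (src_cat S),
    packmap (src_fun S) s = pack c /\ src_value s = pack_value v.

Lemma base_value_exists (A B : Y) (e : small (@lev X n) A B) (c : route A B) :
  exists v, base_value c v.
Proof.
have [S [pS /(_ c)[A0 B0 c0]]] := small_image e.
by exists (ev (src_map S) c0), S; split=> //; exists (pack c0).
Qed.

Definition base (A B : Y) (e : small (@lev X n) A B) (c : route A B) (z : K) :
    chom (O A) (O B) := sval (boolp.cid (base_value_exists e c)) z.2.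

Lemma base_rmap (S : source) (A B : src_cat S) (c : route A B) e :
  prescribed S -> base e (rmap (src_fun S) c) = fun z => ev (src_map S) c z.2.
Proof.
move=> pS; apply/funext => z; rewrite /base;
  case: boolp.cid => v /= [S' [pS' [s [e1 e2]]]].
have := @src_value_unique S' S s (pack c) pS' pS e1.
by rewrite e2 => /pack_value_inj ->.
Qed.

Lemma base_continuous (A B : Y) (e : small (@lev X n) A B) c :
  continuous (base e c).
Proof.
have [S [pS /(_ c) im]] := small_image e; case: im e => A0 B0 c0 e.
by rewrite base_rmap//; exact: (@ev_continuous2 _ _ _ _ (src_map S) _ _ c0).
Qed.

Lemma base_finitary (A B : Y) (e : small (@lev X n) A B) c :
  finitary (rsize c) (base e c).
Proof.
have [S [pS /(_ c) im]] := small_image e; case: im e => A0 B0 c0 e p t t' tt'.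
rewrite rsize_rmap in tt'; rewrite base_rmap//.
exact: (@ev_finitary _ _ _ _ (src_map S) _ _ c0 t t' tt').
Qed.

Variant cut_image (S : source) : forall A B : Y, cut A B -> Prop :=
  CutImage A0 B0 (u : @cut (src_cat S) A0 B0) :
    cut_image S (Cut (rmap (src_fun S) (cleft u)) (rmap (src_fun S) (cright u))).

(** [dec] commutes with [rmap], so every cut of an image is the image of a cut. *)
Lemma image_cut (S : source) (A B : Y) (y : cut A B) :
  image S (ccat y) -> cut_image S y.
Proof.
move=> im; have : exists2 c, image S c & ccat y = c by exists (ccat y).
case=> c {}im yc; case: im y yc => A0 B0 c0 y yc.
have := dec_ccat y; rewrite yc dec_rmap.
by case: dec => //= u /Some_inj <-; exact: CutImage.
Qed.

Lemma base_law1 (A B : Y) (e : small (@lev X n) A B) (y : cut A B)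
    (el : small (@lev X n) A (cmid y)) (er : small (@lev X n) (cmid y) B) z :
  onface z.2 (rsize (cleft y)) true ->
  base e (ccat y) z =
  ccomp (base er (cright y) (zafter (rsize (cleft y)) z)) (base el (cleft y) z).
Proof.
have [S [pS /(_ (ccat y)) /image_cut im]] := small_image e.
case: im e el er => A0 B0 u e el er /= zy.
have cu : ccat (Cut (rmap (src_fun S) (cleft u)) (rmap (src_fun S) (cright u)))
    = rmap (src_fun S) (ccat u) by rewrite rmap_cat.
rewrite cu !base_rmap// rsize_rmap; rewrite rsize_rmap in zy.
by rewrite (ev_law1 (prescribed_flexible pS) zy).
Qed.

Lemma base_law0 (A B : Y) (e : small (@lev X n) A B) (y : cut A B) z :
  onface z.2 (rsize (cleft y)) false ->
  base e (ccat y) z = base e (cmerge y) (zdrop (rsize (cleft y)) z).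
Proof.
have [S [pS /(_ (ccat y)) /image_cut im]] := small_image e.
case: im e => A0 B0 u e /= zy.
have cu : ccat (Cut (rmap (src_fun S) (cleft u)) (rmap (src_fun S) (cright u)))
    = rmap (src_fun S) (ccat u) by rewrite rmap_cat.
have mu :
  cmerge (Cut (rmap (src_fun S) (cleft u)) (rmap (src_fun S) (cright u)))
    = rmap (src_fun S) (cmerge u) by rewrite rmap_merge.
rewrite cu mu !base_rmap// rsize_rmap; rewrite rsize_rmap in zy.
by rewrite (ev_law0 (prescribed_flexible pS) zy).
Qed.

Lemma base_id (A : Y) (e : small (@lev X n) A A) z :
  base e (route1 (cat_id A)) z = cid (O A).
Proof.
case: A e => A l e.
have -> : route1 (cat_id ((A, l) : Y)) = rmap (level X l) (route1 (cat_id A)).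
  by congr route1; rewrite fmap_id.
have pS := PrescribedLevel l.
rewrite (base_rmap (S := level_source l))//.
exact: (@ev_id _ _ _ _ (src_map (level_source l)) A z.2 (prescribed_flexible pS)).
Qed.

(* A morphism factors into morphisms that change the level by at most one, on
   which the values are prescribed. *)
Lemma hom_inhabited (A B : Y) : hom B A -> exists v : chom (O A) (O B), True.
Proof.
have p0 : K := (fun=> clamp 0, fun=> clamp 0).
have [m] := ubnP (lev B - lev A); elim: m A B => // m IH A B;
  rewrite ltnS => AB f.
have [e|ne] := boolP (small (@lev X n) A B).
  by exists (base e (route1 f) p0).
pose M : Y := (B.1, next_level ne).
have [v1 _] : exists v : chom (O A) (O M), True.
  have f' : @hom Y M A := @lift_hom X n A B (next_level ne) f (leqnSn _).
  have e : small (@lev X n) A M by rewrite /small.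
  by exists (base e (route1 f') p0).
have [|v2 _] := @IH M B _ (drop_hom (ltnW (next_level_gt ne))).
  have AB1 : ((lev A).+1 < lev B)%N := next_level_gt ne.
  by have -> : lev M = (lev A).+1 by []; lia.
by exists (ccomp v2 v1).
Qed.

Definition some_value (A B : Y) (c : route A B) : chom (O A) (O B) :=
  sval (boolp.cid (hom_inhabited (route_hom c))).

Lemma prescribed_small (S : source) (A B : src_cat S) : prescribed S ->
  small (@lev X n) (src_fun S A) (src_fun S B).
Proof.
move=> pS; case: pS A B => [i|l] A B; rewrite /small /lev /=;
  last exact: leqnSn.
rewrite !val_ord_step; have := ltn_ord B.2; rewrite ltnS => B1.
by rewrite -addnS leq_add2l (leq_trans B1).
Qed.

End Base.

Arguments src_map {R X C n T} s.

(** * The space of extensions *)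

Section Realization.
Variables (R : realType) (X : category) (C : continuous_category) (n : nat).
Variable T : 'I_n.+1 -> flexible_functor R C X.
Variable G : forall i : 'I_n, Hom_space (fun k : 'I_2 => T (ord_step i k)).
Local Notation Y := (prod_cat X (ordcat n)).
Local Notation O := (Hom_objects T).

Definition extensions : topologicalType :=
  set_type [set F : Hom_space T | forall i : 'I_n, Hom_edge i F = G i].

Definition forget (F : extensions) : prefunctor_space R O :=
  \val (\val (\val F)).

Lemma forget_continuous : continuous forget.
Proof.
apply: (@continuous_comp_fun extensions (Hom_space T) _
  (fun F => \val F) (fun F => \val (\val F))); first exact: initial_continuous.
apply: (@continuous_comp_fun (Hom_space T) (flexible_space R O) _
  (fun F => \val F) (fun F => \val F)); exact: initial_continuous.
Qed.

Lemma continuous_into_extensions (S : topologicalType) (phi : S -> extensions) :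
  continuous (fun s => forget (phi s)) -> continuous phi.
Proof.
by move=> cphi; do 3 apply: continuous_comp_initial.
Qed.

Lemma forget_flexible (F : extensions) : is_flexible (forget F).
Proof. exact: set_mem (valP (\val (\val F))). Qed.

Lemma extensions_eq (F F' : extensions) :
  (forall A B (c : route A B) t, ev (forget F) c t = ev (forget F') c t) ->
  F = F'.
Proof.
by move=> FF'; do 3 apply: val_inj; exact: ev_inj.
Qed.

Lemma forget_source (F : extensions) (S : source T) : prescribed G S ->
  pullback (src_fun S) (forget F) = src_map S.
Proof.
case=> [i|l] /=.
  have /set_mem /(_ i) /(congr1 \val) /(congr1 \val) := valP F.
  by [].
have /set_mem /(_ l) /(congr1 \val) := valP (\val F).
by [].
Qed.

Lemma forget_small (F : extensions) (A B : Y) (e : small (@lev X n) A B)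
    (c : route A B) z : ev (forget F) c z.2 = base G e c z.
Proof.
have [S [pS /(_ c) im]] := small_image G e; case: im e => A0 B0 c0 e.
rewrite base_rmap// -(forget_source F pS).
exact: esym (ev_pullback _ _ _ _).
Qed.

(** * From regular values to maps into the space of extensions *)

Section Realize.
Variable F : values R O.
Hypothesis F_regular : regular F.
Hypothesis F_small : forall A B (e : small (@lev X n) A B) (c : route A B),
  F c = base G e c.

Lemma slice_continuous p (A B : Y) m (c : route A B) :
  continuous (fun t : cube R m => F c (p, extend t)).
Proof.
apply: (@continuous_comp_fun _ _ _ (fun t : cube R m => (p, extend t)) (F c));
  last exact: regular_continuous.
by apply: continuous_pair; [exact: cst_continuous|exact: extend_continuous].
Qed.

Definition slice (p : Ivec R) : prefunctor_space R O := fun s =>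
  mkcts (@slice_continuous p _ _ (cs_dim s) (of_chain s)).

Lemma slice_value p m (A B : Y) (c : chain m A B) t :
  value (slice p) c t = F (of_chain c) (p, extend t).
Proof. by []. Qed.

Lemma ev_slice p (A B : Y) (c : route A B) t :
  ev (slice p) c t = F c (p, t).
Proof.
(* The length [m] is kept variable so that [c] can be replaced by [of_chain c']. *)
have ec (m : nat) (c' : chain m A B) : c = of_chain c' ->
    ev (slice p) c t = F c (p, t).
  move=> ->; rewrite ev_of_chain slice_value.
  apply: (regular_finitary F_regular) => i; rewrite rsize_of_chain => im.
  by rewrite (extend_lt _ im).
apply: (ec _ (to_chain c)).
by elim: c {ec} => //= A' X' B' f c <-.
Qed.

Lemma slice_flexible p : is_flexible (slice p).
Proof.
split=> [q r A B D a b t t0|q r A B D a b t t1|A t].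
- rewrite !slice_value of_chain_cat of_chain_merge.
  have := @regular_law0 _ _ _ _ _ F_regular _ _ (Cut (of_chain a) (of_chain b))
    (p, extend t).
  rewrite /= /onface rsize_of_chain (extend_lt _ (ltn_ord (cut_pos q r))).
  rewrite (_ : Ordinal _ = cut_pos q r); last exact: val_inj.
  move=> /(_ t0) ->; apply: (regular_finitary F_regular) => i.
  rewrite rsize_merge !rsize_of_chain => ir.
  rewrite (extend_lt _ ir) /cube_drop -extendE; congr (extend t _).
- rewrite !slice_value of_chain_cat.
  have := @regular_law1 _ _ _ _ _ F_regular _ _ (Cut (of_chain a) (of_chain b))
    (p, extend t).
  rewrite /= /onface rsize_of_chain (extend_lt _ (ltn_ord (cut_pos q r))).
  rewrite (_ : Ordinal _ = cut_pos q r); last exact: val_inj.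
  move=> /(_ t1) ->; rewrite /compose_at /= rsize_of_chain; congr ccomp.
    apply: (regular_finitary F_regular) => i; rewrite rsize_of_chain => ir.
    rewrite (extend_lt _ ir) /cube_after -extendE; congr (extend t _).
    by rewrite /= /bump leq_addr.
  apply: (regular_finitary F_regular) => i; rewrite rsize_of_chain => ir.
  rewrite (extend_lt _ ir) /cube_before -extendE; congr (extend t _).
  by rewrite /= /bump leqNgt ir.
- have e : small (@lev X n) A A by rewrite /small leqnSn.
  by rewrite slice_value /= (F_small e) base_id.
Qed.

Lemma pullback_slice p (S : source T) : prescribed G S ->
  pullback (src_fun S) (slice p) = src_map S.
Proof.
move=> pS; apply: ev_inj => A B c t; rewrite ev_pullback ev_slice.
by rewrite (F_small (prescribed_small A B pS)) base_rmap.
Qed.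

(** Regular values are jointly continuous in parameters and coordinates; currying makes them a
    continuous map into the function spaces. *)
Lemma realization : exists phi : Ivec R -> extensions, continuous phi /\
  forall p A B (c : route A B) t, ev (forget (phi p)) c t = F c (p, t).
Proof.
pose f1 p : flexible_space R O :=
  exist (fun H => H \in @is_flexible R C Y O) _ (mem_set (slice_flexible p)).
have f1T p : f1 p \in @restricts_to R C X n T.
  apply/mem_set => l; apply: val_inj.
  exact: (pullback_slice p (PrescribedLevel G l)).
pose f2 p : Hom_space T :=
  exist (fun H => H \in @restricts_to R C X n T) _ (f1T p).
have f2G p : f2 p \in [set F : Hom_space T | forall i :
  'I_n, Hom_edge i F = G i].
  apply/mem_set => i; do 2 apply: val_inj.
  exact: (pullback_slice p (PrescribedEdge G i)).
pose phi p : extensions := exist (fun H => H \in _) _ (f2G p).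
exists phi; split; last by move=> p A B c t; exact: ev_slice.
apply: continuous_into_extensions; apply: continuous_into_prod => s.
apply: map_space_curry.
apply: (@continuous_comp_fun _ _ _
  (fun z : Ivec R * cube R (cs_dim s) => (z.1, extend z.2)) (F (of_chain s)));
  last exact: regular_continuous.
have [c1 c2] := continuous_fst_snd (Ivec R) (cube R (cs_dim s)).
apply: continuous_pair => //.
exact: (continuous_comp_fun c2 (@extend_continuous R _)).
Qed.

End Realize.

Lemma extension_of_boundary k (h : 'I_k -> bool -> Ivec R -> extensions) :
  (forall i e, continuous (h i e)) ->
  (forall (i j : 'I_k) e d p, onface p i e -> onface p j d ->
    h i e p = h j d p) ->
  exists phi : Ivec R -> extensions, continuous phi /\
    forall (i : 'I_k) e p, onface p i e -> phi p = h i e p.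
Proof.
move=> hc hh.
pose H (i : 'I_k) (e : bool) : values R O := fun A B c z =>
  ev (forget (h i e z.1)) c z.2.
have H_regular i e : regular (H i e).
  split=> [A B c|A B c p t t' tt'|A B y z|A B y z].
  - apply: (ev_continuous (phi := fun p => forget (h i e p))).
    exact: (continuous_comp_fun (hc i e) forget_continuous).
  - exact: ev_finitary.
  - exact/ev_law1/forget_flexible.
  - exact/ev_law0/forget_flexible.
have [F [rF sF FH]] := @extension_exists R C Y O (@lev X n) (@lev_mono X n)
  (@base _ _ _ _ _ G) (@base_continuous _ _ _ _ _ G)
  (@base_finitary _ _ _ _ _ G) (@base_law1 _ _ _ _ _ G)
  (@base_law0 _ _ _ _ _ G) k H H_regular
  (fun i e A B s c z => forget_small (h i e z.1) s c z)
  (fun i i' e e' A B c z zi zi' =>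
     congr1 (fun F => ev (forget F) c z.2) (hh i i' e e' z.1 zi zi'))
  (@cutof X n) (@cutof_good X n) (@cutof_merge X n) (@cutof_left X n)
  (@some_value _ _ _ _ _ G).
have [phi [cphi phiE]] := realization rF sF.
exists phi; split=> // i e p pi; apply: extensions_eq => A B c t.
by rewrite phiE (FH i e A B c (p, t)).
Qed.

Lemma extensions_contractible : weakly_contractible R extensions.
Proof.
split.
  (* The parameter cube of dimension 0 has no faces; extending over it yields a point. *)
  have h0 : 'I_0 -> bool -> Ivec R -> extensions by case.
  have [[]|[]|phi _] := extension_of_boundary (h := h0) => //.
  by exists (phi (fun=> clamp 0)).
move=> k z f cf fz.
(* The last of the [k + 1] parameters is the time of the homotopy: [f] is prescribed at time 0 and
   the constant [z] on all other faces. *)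
pose h (i : 'I_k.+1) (e : bool) (p : Ivec R) : extensions :=
  if (i == ord_max) && ~~ e then f (restr k p) else z.
have bz (i : 'I_k.+1) e p : onface p i e -> i != ord_max -> f (restr k p) = z.
  move=> pi ni; have ik : (i < k)%N.
    by rewrite ltn_neqAle -ltnS ltn_ord andbT.
  apply: fz; exists (Ordinal ik); move: pi; rewrite /onface /restr /= => ->.
  by case: e; [right|left].
have [i e|i j e d p pi pj|phi [cphi phiE]] := @extension_of_boundary k.+1 h.
- rewrite /h; case: (_ && _); last exact: cst_continuous.
  exact: (continuous_comp_fun (@restr_continuous R k) cf).
- rewrite /h; have [im|ni] := eqVneq i ord_max;
    have [jm|nj] := eqVneq j ord_max.
  + by move: pi pj; rewrite im jm => pi /(onface_inj pi) ->.
  + by case: e pi => // pi; exact: bz pj nj.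
  + by case: d pj => // pj; rewrite (bz i e p pi ni).
  + by [].
(* The time [s] becomes coordinate [k]; the later coordinates are filled with it as well. *)
pose join (x : cube R k) (s : unit_interval R) : Ivec R :=
  fun i => if insub i is Some j then x j else s.
have joinE x s (i : 'I_k) : join x s i = x i by rewrite /join valK.
have join_last x s : join x s k = s by rewrite /join insubN// ltnn.
have restr_join x s : restr k (join x s) = x by apply/funext => i; exact: joinE.
exists (fun xs => phi (join xs.1 xs.2)); split.
- apply: (@continuous_comp_fun (cube R k * unit_interval R)%type _ _
    (fun xs => join xs.1 xs.2)) => //.
  have [c1 c2] := continuous_fst_snd (cube R k) (unit_interval R).
  apply: continuous_into_prod => i; rewrite /join.
  case: insubP => [j _ _|_] //.
  apply: (@continuous_comp_fun _ (cube R k) _ fst (fun x => x j)) => //.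
  exact: continuous_eval.
- move=> x s s0; rewrite (phiE ord_max false); last first.
    by rewrite /onface /= join_last.
  by rewrite /h eqxx /= restr_join.
- move=> x s s1; rewrite (phiE ord_max true); last first.
    by rewrite /onface /= join_last.
  by rewrite /h andbF.
- move=> x s bx; rewrite (fz x bx); have [i xi] := bx.
  pose i' : 'I_k.+1 := widen_ord (leqnSn k) i.
  have ni : i' != ord_max.
    by apply/eqP => /(congr1 val) /= ik; have := ltn_ord i; rewrite ik ltnn.
  have [e xe] : exists e : bool, onface (join x s) i' e.
    by case: xi => xi; [exists false|exists true]; rewrite /onface /= joinE.
  by rewrite (phiE i' e)//= /h (negbTE ni).
Qed.

End Realization.

Theorem theorem2p1 (R : realType) (X : category) (C : continuous_category)
    (n : nat) (T : 'I_n.+1 -> flexible_functor R C X)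
    (G : forall i : 'I_n, Hom_space (fun k : 'I_2 => T (ord_step i k))) :
  weakly_contractible R
    (set_type [set F : Hom_space T | forall i : 'I_n, Hom_edge i F = G i]).
Proof. exact: extensions_contractible. Qed.
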